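(* Let $C\subset\mathbb{CP}^2$ be the irreducible plane algebraic curve given by the determinantal representation $\Delta(x_0,x_1,x_2)=\det(x_0D_0+x_1D_1+x_2D_2)$, where $D_0,D_1,D_2$ are complex Hermitian $m\times m$ matrices. Two homogeneous polynomials $p,q$ of degree $n$ in $(x_0,x_1,x_2)$ have a common zero on $C$ if and only if the determinant of their Bezout matrix $B'(p,q)$ along $C$ is equal to zero.
   Context: Setting: $\Delta$ is irreducible with real coefficients and $C=\{\Delta=0\}\subset\mathbb{CP}^2$. Spaces: for multi-indices $i=(i_0,i_1,i_2)\in\mathbb{Z}_{\ge0}^3$ put $|i|=i_0+i_1+i_2$ and $x^i=x_0^{i_0}x_1^{i_1}x_2^{i_2}$. The blown space $W_n$ is the complex Euclidean space of families $(w_i)_{|i|=n-1}$ with $w_i\in\mathbb{C}^m$. The principal subspace is $V_n=\{(w_i)\in W_n: D_0w_{j_0+1,j_1,j_2}+D_1w_{j_0,j_1+1,j_2}+D_2w_{j_0,j_1,j_2+1}=0 \text{ for all } |j|=n-2\}$; it has dimension $nm$. Bezout matrix: for $p,q$ homogeneous of degree $n$ there exist symmetric $\frac{n(n+1)}{2}\times\frac{n(n+1)}{2}$ matrices $\beta^{10},\beta^{20},\beta^{12}$, indexed by multi-indices $i,j$ with $|i|=|j|=n-1$, such that $p(x)q(y)-q(x)p(y)=\sum_{i,j}\big(\beta^{10}_{ij}x^i(x_1y_0-x_0y_1)y^j+\beta^{20}_{ij}x^i(x_2y_0-x_0y_2)y^j+\beta^{12}_{ij}x^i(x_1y_2-x_2y_1)y^j\big)$.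 Put $B(p,q)=\beta^{12}\otimes D_0+\beta^{10}\otimes D_1+\beta^{20}\otimes D_2$ on $W_n$. The Bezout matrix of $p$ and $q$ along $C$ is the restriction $B'(p,q)=\mathcal P_{V_n}B(p,q)\mathcal P_{V_n}$, regarded as an operator on $V_n$, where $\mathcal P_{V_n}$ is the orthogonal projection onto $V_n$.
   Formalization: The Bezout matrix is taken as B(p,q) = β¹²⊗D₀ + β²⁰⊗D₁ − β¹⁰⊗D₂ instead of β¹²⊗D₀ + β¹⁰⊗D₁ + β²⁰⊗D₂, for which the claim fails (e.g. Δ = x₁, p = x₀, q = x₂); the degree n is at least 1. *)

(* Defs.v *)
From HB Require Import structures.
From mathcomp Require Import all_boot all_order all_algebra.
From mathcomp Require Import reals.
From mathcomp Require Import complex.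
From mathcomp Require Import mpoly.
From mathcomp Require Import ring zify.

Set Implicit Arguments.
Unset Strict Implicit.
Unset Printing Implicit Defensive.

Import Order.TTheory GRing.Theory Num.Theory Num.Def.
Local Open Scope ring_scope.

Definition irreducible_elt (A : idomainType) (a : A) : Prop :=
  [/\ a != 0, a \isn't a GRing.unit &
      forall b c : A, a = b * c -> b \is a GRing.unit \/ c \is a GRing.unit].

Definition lfun_det (K : fieldType) (vT : vectType K) (f : 'End(vT)) : K :=
  \det (passmx.mxof (vbasis {:vT}) (vbasis {:vT}) f).

(* The multi-indices i with |i| = n - 1.  Writing this as |i| + 1 = n avoids
   truncated subtraction: [mindex n.-1] is then exactly the set |j| = n - 2,
   which is empty for n = 1. *)
Definition mindex (n : nat) := {i : 'X_{1..3 < n} | (mdeg i).+1 == n}.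

Definition mnm_of (n : nat) (i : mindex n) : 'X_{1..3} := val (val i).

Lemma mnm_ofP n (i : mindex n) : (mdeg (mnm_of i)).+1 = n.
Proof. exact/eqP/(valP i). Qed.

Lemma mindex_ltn n (a : 'X_{1..3}) : (mdeg a).+1 == n -> (mdeg a < n)%N.
Proof. by move=> /eqP <-. Qed.

Definition mk_mindex n (a : 'X_{1..3}) (ha : (mdeg a).+1 == n) : mindex n :=
  exist (fun i : 'X_{1..3 < n} => (mdeg i).+1 == n)
        (BMultinom (mindex_ltn ha)) ha.

Lemma mindex_succP n (j : mindex n.-1) (k : 'I_3) :
  (mdeg (mnm_of j + U_(k))).+1 == n.
Proof.
by have := mnm_ofP j; rewrite mdegD mdeg1 addn1; case: n j => //= n j ->.
Qed.

(* j + e_k, where |j| = n - 2 *)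
Definition mindex_succ n (j : mindex n.-1) (k : 'I_3) : mindex n :=
  mk_mindex (mindex_succP j k).

Section Bezout.
Variables (C : numClosedFieldType) (m n : nat).
Implicit Types (D : 'I_3 -> 'M[C]_m) (p q : {mpoly C[3]}) (x y : 'I_3 -> C).
Implicit Types (b : mindex n -> mindex n -> C).

(* When the D_k are Hermitian, the coefficients of Delta are automatically real. *)
Definition Delta D : {mpoly C[3]} :=
  \det (\sum_(k < 3) 'X_k *: map_mx (@mpolyC 3 C) (D k)).

Definition common_zero_on D p q : Prop :=
  exists x, [/\ exists k, x k != 0, (Delta D).@[x] = 0, p.@[x] = 0 & q.@[x] = 0].

(* The blown space W_n. *)
Definition blown := {ffun mindex n -> 'cV[C]_m}.

Definition blown_dot (v w : blown) : C :=
  \sum_i \sum_(k < m) v i k 0 * (w i k 0)^*.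

Definition principal_map D (w : blown) : {ffun mindex n.-1 -> 'cV[C]_m} :=
  [ffun j => \sum_(k < 3) D k *m w (mindex_succ j k)].

(* b (x) A acting on W_n *)
Definition tens_map b (A : 'M[C]_m) (w : blown) : blown :=
  [ffun i => \sum_j b i j *: (A *m w j)].

Lemma blown_dot_bilinear : bilinear_for
  (GRing.Scale.Law.clone _ _ *%R _) (GRing.Scale.Law.clone _ _ (conjC \; *%R) _)
  blown_dot.
Proof.
split=> [w|v] a u1 u2; rewrite /blown_dot /= ?mulr_sumr -big_split /=;
  apply: eq_bigr => i _; rewrite mulr_sumr -big_split /=;
  apply: eq_bigr => k _; rewrite !ffunE !mxE.
- by rewrite mulrDl mulrA.
- by rewrite rmorphD rmorphM mulrDr mulrCA.
Qed.

HB.instance Definition _ := bilinear_isBilinear.Build C blown blown C _ _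
  blown_dot blown_dot_bilinear.

Lemma blown_dot_herm (v w : blown) :
  blown_dot v w = (-1) ^+ false * (blown_dot w v)^*.
Proof.
rewrite expr0 mul1r rmorph_sum; apply: eq_bigr => i _.
rewrite rmorph_sum; apply: eq_bigr => k _.
by rewrite rmorphM /= conjCK mulrC.
Qed.

HB.instance Definition _ := isHermitianSesquilinear.Build C blown false conjC
  blown_dot blown_dot_herm.

Lemma blown_dot_gt0 (v : blown) : v != 0 -> 0 < blown_dot v v.
Proof.
move=> v0; have ge0 i k : 0 <= v i k 0 * (v i k 0)^* by exact: mul_conjC_ge0.
rewrite lt_def sumr_ge0 ?andbT => [|i _]; last exact: sumr_ge0.
apply: contraNneq v0 => /psumr_eq0P v0; apply/eqP/ffunP => i; apply/colP => k.
have /psumr_eq0P h : \sum_(k < m) v i k 0 * (v i k 0)^* = 0.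
  by apply: v0 => // i' _; exact: sumr_ge0.
by rewrite ffunE mxE; apply/eqP; rewrite -mul_conjC_eq0 h.
Qed.

HB.instance Definition _ := isDotProduct.Build C blown blown_dot blown_dot_gt0.

Lemma principal_map_linear D : linear (principal_map D).
Proof.
move=> a v w; apply/ffunP => j; rewrite !ffunE scaler_sumr -big_split /=.
by apply: eq_bigr => k _; rewrite !ffunE mulmxDr scalemxAr.
Qed.

HB.instance Definition _ D :=
  GRing.isSemilinear.Build C blown {ffun mindex n.-1 -> 'cV[C]_m} _
    (principal_map D) (GRing.semilinear_linear (principal_map_linear D)).

Lemma tens_map_linear b A : linear (tens_map b A).
Proof.
move=> a v w; apply/ffunP => i; rewrite !ffunE scaler_sumr -big_split /=.
apply: eq_bigr => j _; rewrite !ffunE mulmxDr scalerDr -scalemxAr.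
by rewrite !scalerA mulrC.
Qed.

HB.instance Definition _ b A :=
  GRing.isSemilinear.Build C blown blown _
    (tens_map b A) (GRing.semilinear_linear (tens_map_linear b A)).

(* The principal subspace V_n. *)
Definition principal D : {vspace blown} := lker (linfun (principal_map D)).

Lemma principalP D (w : blown) :
  reflect (forall j : mindex n.-1, \sum_(k < 3) D k *m w (mindex_succ j k) = 0)
          (w \in principal D).
Proof.
rewrite memv_ker lfunE /=; apply: (iffP eqP) => [/ffunP h j | h].
  by have := h j; rewrite !ffunE.
by apply/ffunP => j; rewrite !ffunE h.
Qed.

(* Orthogonal projection onto V: the projection onto V along its orthogonal
   complement for the standard Hermitian inner product. *)
Definition orthoproj (V : {vspace blown}) : 'End(blown) :=
  daddv_pi V (orthov blown_dot V).

Lemma orthoproj_mem V w : orthoproj V w \in V.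
Proof. exact: memv_pi. Qed.

Lemma orthov_disjoint V : (V :&: orthov blown_dot V = 0)%VS.
Proof.
apply/eqP; rewrite -subv0; apply/subvP => v /memv_capP[vV vO].
rewrite memv0 -(dnorm_eq0 (blown_dot : {dot blown for conjC})).
by apply/eqP/(mem_orthovP vO).
Qed.

Lemma orthov_full V : (V + orthov blown_dot V = fullv)%VS.
Proof.
apply/eqP; rewrite eqEdim subvf /= dimv_disjoint_sum ?orthov_disjoint //.
pose e := vbasis V.
pose f (w : blown) : 'rV[C]_(\dim V) := \row_i blown_dot w e`_i.
have fL : linear f.
  by move=> a u v; apply/rowP => i; rewrite !mxE linearPl.
pose fl : {linear blown -> 'rV[C]_(\dim V)} := HB.pack f
  (GRing.isSemilinear.Build C blown 'rV[C]_(\dim V) _ f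
     (GRing.semilinear_linear fL)).
rewrite -(limg_ker_dim (linfun fl) fullv) capfv addnC leq_add //.
  apply: leq_trans (dimvS (subvf _)) _; rewrite dimvf dim_matrix.
  by rewrite mul1r.
apply/dimvS/subvP => w; rewrite memv_ker lfunE /= => /eqP/rowP fw0.
apply/mem_orthovP => v vV; rewrite (coord_vbasis vV) linear_sumr big1 //= => i _.
by have := fw0 i; rewrite linearZr_LR /= !mxE => ->; rewrite mulr0.
Qed.

Lemma orthoproj_ortho (V : {vspace blown}) (w v : blown) :
  v \in V -> blown_dot (w - orthoproj V w) v = 0.
Proof.
move=> vV; have wF : w \in (V + orthov blown_dot V)%VS.
  by rewrite orthov_full memvf.
rewrite -[X in X - _](daddv_pi_add (orthov_disjoint V) wF) addrC addKr.
by apply: (mem_orthovP (memv_pi _ _ _) v vV).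
Qed.

(* The matrices beta^10, beta^20, beta^12 attached to p and q. *)
Definition bezout_coeffs p q b10 b20 b12 : Prop :=
  [/\ forall i j, b10 i j = b10 j i,
      forall i j, b20 i j = b20 j i,
      forall i j, b12 i j = b12 j i &
      forall x y,
        let pow z (i : mindex n) := \prod_(k < 3) z k ^+ mnm_of i k in
        p.@[x] * q.@[y] - q.@[x] * p.@[y] =
        \sum_i \sum_j
          (b10 i j * pow x i * (x 1 * y 0 - x 0 * y 1) * pow y j
         + b20 i j * pow x i * (x 2 * y 0 - x 0 * y 2) * pow y j
         + b12 i j * pow x i * (x 1 * y 2 - x 2 * y 1) * pow y j)].

(* In the identity above the coefficients of b12, b20 and b10 are the
   coordinates number 0, 1 and, up to sign, 2 of the cross product of x and y,
   while u^* D_k v is proportional to the k-th coordinate of that product when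
   (\sum_k conj(x_k) D_k) u = 0 and (\sum_k y_k D_k) v = 0.  This dictates the
   pairing of the beta's with the D_k: b20 goes with D_1 and -b10 with D_2. *)
Definition bezout D b10 b20 b12 : 'End(blown) :=
  linfun (tens_map b12 (D 0)) + linfun (tens_map b20 (D 1))
  - linfun (tens_map b10 (D 2)).

Definition bezout_along D b10 b20 b12 : 'End(subvs_of (principal D)) :=
  let P := orthoproj (principal D) in
  (linfun (@vsproj _ _ (principal D)) \o (P \o bezout D b10 b20 b12 \o P)
     \o linfun (@vsval _ _ (principal D)))%VF.

End Bezout.

Section BezoutExists.
Variables (C : numClosedFieldType) (n : nat).
Implicit Types (a : 'X_{1..3}) (x y : 'I_3 -> C).

Let pow x a : C := \prod_(k < 3) x k ^+ a k.

Let term (b10 b20 b12 : mindex n -> mindex n -> C) x y (i j : mindex n) : C :=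
   (b10 i j * pow x (mnm_of i) * (x 1 * y 0 - x 0 * y 1) * pow y (mnm_of j)
  + b20 i j * pow x (mnm_of i) * (x 2 * y 0 - x 0 * y 2) * pow y (mnm_of j)
  + b12 i j * pow x (mnm_of i) * (x 1 * y 2 - x 2 * y 1) * pow y (mnm_of j)).

Let bzrep (F : ('I_3 -> C) -> ('I_3 -> C) -> C) : Prop :=
  exists b10 b20 b12, forall x y, F x y = \sum_i \sum_j term b10 b20 b12 x y i j.

Lemma bzrep0 : bzrep (fun _ _ => 0).
Proof.
exists (fun _ _ => 0), (fun _ _ => 0), (fun _ _ => 0) => x y.
by rewrite big1 // => i _; rewrite big1 // => j _; rewrite /term; ring.
Qed.

Lemma bzrepP c F G : bzrep F -> bzrep G -> bzrep (fun x y => c * F x y + G x y).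
Proof.
move=> [f1 [f2 [f3 hF]]] [g1 [g2 [g3 hG]]].
exists (fun i j => c * f1 i j + g1 i j), (fun i j => c * f2 i j + g2 i j),
  (fun i j => c * f3 i j + g3 i j) => x y.
rewrite hF hG mulr_sumr -big_split; apply: eq_bigr => i _ /=.
rewrite mulr_sumr -big_split; apply: eq_bigr => j _ /=.
by rewrite /term; ring.
Qed.

Lemma bzrep_ext F G : (forall x y, F x y = G x y) -> bzrep F -> bzrep G.
Proof. by move=> e [f1 [f2 [f3 h]]]; exists f1, f2, f3 => x y; rewrite -e. Qed.

Lemma bzrep_sum (I : Type) (r : seq I) (c : I -> C) F :
  (forall i, bzrep (F i)) -> bzrep (fun x y => \sum_(i <- r) c i * F i x y).
Proof.
move=> h; elim: r => [|i r IH].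
  by apply: bzrep_ext bzrep0 => x y; rewrite big_nil.
by apply: bzrep_ext (bzrepP (c i) (h i) IH) => x y; rewrite big_cons.
Qed.

Lemma bzsum_delta (i0 j0 : mindex n) (F : mindex n -> mindex n -> C) :
  \sum_i \sum_j ((i == i0) && (j == j0))%:R * F i j = F i0 j0.
Proof.
rewrite (bigD1 i0) //= (bigD1 j0) //= !eqxx mul1r big1 ?addr0 => [|j /negPf->].
  rewrite big1 ?addr0 // => i /negPf->; rewrite big1 // => j _.
  by rewrite mul0r.
by rewrite andbF mul0r.
Qed.

Lemma bzrep_base (i j : mindex n) (k l : 'I_3) :
  bzrep (fun x y => pow x (mnm_of i) * (x k * y l - x l * y k) * pow y (mnm_of j)).
Proof.
pose d c i' j' : C := ((i' == i) && (j' == j))%:R * c.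
have base c1 c2 c3 : bzrep (fun x y => pow x (mnm_of i) *
   (c1 * (x 1 * y 0 - x 0 * y 1) + c2 * (x 2 * y 0 - x 0 * y 2)
    + c3 * (x 1 * y 2 - x 2 * y 1)) * pow y (mnm_of j)).
  exists (d c1), (d c2), (d c3) => x y.
  rewrite -(bzsum_delta i j (fun i j => pow x (mnm_of i) *
   (c1 * (x 1 * y 0 - x 0 * y 1) + c2 * (x 2 * y 0 - x 0 * y 2)
    + c3 * (x 1 * y 2 - x 2 * y 1)) * pow y (mnm_of j))).
  apply: eq_bigr => i' _; apply: eq_bigr => j' _; rewrite /term /d; ring.
have o0 (h : (0 < 3)%N) : Ordinal h = 0 by apply/val_inj.
have o1 (h : (1 < 3)%N) : Ordinal h = 1 by apply/val_inj.
have o2 (h : (2 < 3)%N) : Ordinal h = 2 by apply/val_inj.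
case: k => [[|[|[|k]]] hk] //; case: l => [[|[|[|l]]] hl] //;
  rewrite ?o0 ?o1 ?o2.
- by apply: bzrep_ext (base 0 0 0) => x y; ring.
- by apply: bzrep_ext (base (-1) 0 0) => x y; ring.
- by apply: bzrep_ext (base 0 (-1) 0) => x y; ring.
- by apply: bzrep_ext (base 1 0 0) => x y; ring.
- by apply: bzrep_ext (base 0 0 0) => x y; ring.
- by apply: bzrep_ext (base 0 0 1) => x y; ring.
- by apply: bzrep_ext (base 0 1 0) => x y; ring.
- by apply: bzrep_ext (base 0 0 (-1)) => x y; ring.
- by apply: bzrep_ext (base 0 0 0) => x y; ring.
Qed.

Lemma bzpowU x a k : pow x (a + U_(k))%MM = pow x a * x k.
Proof.
rewrite /pow (bigD1 k) //= [in RHS](bigD1 k) //= mnmDE mnm1E eqxx addn1 exprS.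
rewrite (eq_bigr (fun i => x i ^+ a i)) => [|i /negPf ik]; first by ring.
by rewrite mnmDE mnm1E eq_sym ik addn0.
Qed.

Lemma mdeg_lt_ex a1 a2 k : mdeg a1 = mdeg a2 -> (a1 k < a2 k)%N ->
  exists l, (a2 l < a1 l)%N.
Proof.
move=> e lt; apply/existsP; apply: contraLR lt => /existsPn h.
have le l : (a1 l <= a2 l)%N by have := h l; rewrite -leqNgt.
rewrite -leqNgt leqNgt; apply/negP => lt.
suff: (mdeg a1 < mdeg a2)%N by rewrite e ltnn.
rewrite !mdegE (bigD1 k) // [X in (_ < X)%N](bigD1 k) //=.
by rewrite -addSn leq_add // leq_sum.
Qed.

Lemma bzrep_mono d a1 b1 a2 b2 :
  (\sum_(k < 3) (a1 k - a2 k) <= d)%N ->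
  mdeg a1 = n -> mdeg b1 = n -> mdeg a2 = n -> (a1 + b1 = a2 + b2)%MM ->
  bzrep (fun x y => pow x a1 * pow y b1 - pow x a2 * pow y b2).
Proof.
elim: d a1 b1 => [|d IH] a1 b1 hd da1 db1 da2 e.
all: have [/existsP[k ltk] | /existsPn nlt] := boolP [exists k, (a2 k < a1 k)%N].
- by move: hd; rewrite leqn0 (bigD1 k) //= addn_eq0 subn_eq0 leqNgt ltk.
- have E : a1 = a2.
    apply/mnmP => k; apply/eqP; rewrite eqn_leq leqNgt nlt /= leqNgt.
    apply/negP => /(mdeg_lt_ex (etrans da1 (esym da2)))[l].
    by rewrite (negPf (nlt l)).
  have E' : b1 = b2.
    by apply/mnmP => k; have /mnmP/(_ k) := e; rewrite E !mnmDE => /addnI.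
  by apply: bzrep_ext bzrep0 => x y; rewrite E E' subrr.
- have [l ltl] := mdeg_lt_ex (etrans da2 (esym da1)) ltk.
  have lel : (U_(l) <= b1)%MM.
    have /mnmP/(_ l) := e; rewrite !mnmDE => el.
    apply/mnm_lepP => s; rewrite mnm1E; case: eqP => // <-; lia.
  have lek : (U_(k) <= a1)%MM.
    by apply/mnm_lepP => s; rewrite mnm1E; case: eqP => // <-; lia.
  pose i := (a1 - U_(k))%MM; pose j := (b1 - U_(l))%MM.
  have Ea : a1 = (i + U_(k))%MM by rewrite submK.
  have Eb : b1 = (j + U_(l))%MM by rewrite submK.
  have di : (mdeg i).+1 == n by rewrite -da1 Ea mdegD mdeg1 addn1.
  have dj : (mdeg j).+1 == n by rewrite -db1 Eb mdegD mdeg1 addn1.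
  have kl : k != l by apply: contraTneq ltk => ->; rewrite -leqNgt ltnW.
  have hd' : (\sum_(s < 3) ((i + U_(l))%MM s - a2 s) <= d)%N.
    rewrite -ltnS; apply: leq_trans hd.
    rewrite (bigD1 k) // [X in (_ < X)%N](bigD1 k) //= -addSn leq_add //.
      rewrite mnmDE mnmBE !mnm1E eqxx eq_sym (negPf kl); lia.
    apply: leq_sum => s sk; rewrite mnmDE mnmBE !mnm1E [k == s]eq_sym (negPf sk).
    by case: eqP => [<-|_]; lia.
  have R2 : bzrep (fun x y =>
      pow x (i + U_(l))%MM * pow y (j + U_(k))%MM - pow x a2 * pow y b2).
    apply: (IH _ _ hd') => //; rewrite ?mdegD ?mdeg1 ?addn1; [exact/eqP|exact/eqP|].
    by rewrite -e Ea Eb; apply/mnmP => t; rewrite !mnmDE; lia.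
  apply: bzrep_ext (bzrepP 1 (bzrep_base (mk_mindex di) (mk_mindex dj) k l) R2) => x y.
  rewrite /mnm_of /= Ea Eb !bzpowU; ring.
- have E : a1 = a2.
    apply/mnmP => k; apply/eqP; rewrite eqn_leq leqNgt nlt /= leqNgt.
    apply/negP => /(mdeg_lt_ex (etrans da1 (esym da2)))[l].
    by rewrite (negPf (nlt l)).
  have E' : b1 = b2.
    by apply/mnmP => k; have /mnmP/(_ k) := e; rewrite E !mnmDE => /addnI.
  by apply: bzrep_ext bzrep0 => x y; rewrite E E' subrr.
Qed.

Lemma bezout_coeffs_exist (p q : {mpoly C[3]}) :
  p \is n.-homog -> q \is n.-homog ->
  exists b10 b20 b12 : mindex n -> mindex n -> C,
    bezout_coeffs p q b10 b20 b12.
Proof.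
move=> hp hq.
have R : bzrep (fun x y => \sum_(u <- msupp p) p@_u * \sum_(v <- msupp q) q@_v *
    (if (u \in msupp p) && (v \in msupp q)
     then pow x u * pow y v - pow x v * pow y u else 0)).
  apply: bzrep_sum => u; apply: bzrep_sum => v; 
  have [/andP[pu qv]|_] := boolP ((u \in _) && (v \in _)).
    apply: bzrep_mono (leqnn _) _ _ _ _.
    - exact: dhomog_mf hp _ pu.
    - exact: dhomog_mf hq _ qv.
    - exact: dhomog_mf hq _ qv.
    - exact: addmC.
  exact: bzrep0.
have {R} [f1 [f2 [f3 hF]]] : bzrep (fun x y => p.@[x] * q.@[y] - q.@[x] * p.@[y]).
  apply: bzrep_ext R => x y; rewrite !mevalE.
  rewrite [X in _ = _ - X]mulrC !mulr_suml -sumrB big_seq [RHS]big_seq.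
  apply: eq_bigr => u pu; rewrite !mulr_sumr -sumrB big_seq [RHS]big_seq.
  by apply: eq_bigr => v qv; rewrite pu qv /= /pow; ring.
pose s (f : mindex n -> mindex n -> C) i j := 2%:R^-1 * (f i j + f j i).
have sC f i j : s f i j = s f j i by rewrite /s addrC.
exists (s f1), (s f2), (s f3); split=> // x y /=.
have two : 2 != 0 :> C by rewrite pnatr_eq0.
have -> : p.@[x] * q.@[y] - q.@[x] * p.@[y] =
    2^-1 * ((p.@[x] * q.@[y] - q.@[x] * p.@[y])
            - (p.@[y] * q.@[x] - q.@[y] * p.@[x])) by field.
rewrite !hF [X in _ - X]exchange_big -sumrB mulr_sumr; apply: eq_bigr => i _.
rewrite -sumrB mulr_sumr; apply: eq_bigr => j _.
rewrite /s /term /pow; ring.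
Qed.
End BezoutExists.

(* Main.v *)
From HB Require Import structures.
Require Import Defs.
From mathcomp Require Import all_boot all_order all_algebra.
From mathcomp Require Import reals.
From mathcomp Require Import complex.
From mathcomp Require Import mpoly.
From mathcomp Require Import ring zify.

Set Implicit Arguments.
Unset Strict Implicit.
Unset Printing Implicit Defensive.

Import Order.TTheory GRing.Theory Num.Theory.
Local Open Scope ring_scope.

(* Write U(x) = x_0 D_0 + x_1 D_1 + x_2 D_2 and read a vector w of the blown space
   of forms of degree d as a C^m-valued functional on them; w is principal when it
   kills U times forms of degree d - 1.  After choosing z with z_2 = 1 and U(z)
   invertible, put lambda = x_0 - z_0 x_2, mu = x_1 - z_1 x_2, the two linear forms
   vanishing at z.  The Bezout matrices enter only through the identity
     beta(phi mu, w lambda) - beta(phi lambda, w mu)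
       = phi(q)^T U(z) w(p) - phi(p)^T U(z) w(q)
   for functionals w, phi of degree n, principal for the D_k and for their
   transposes respectively, where beta is the bilinear form of B(p, q) and
   (w l)(f) = w(l f).
   A common zero x, with U(x) v = 0, gives the kernel vector f |-> f(x) v.
   Conversely, replace p by some p + c q without zeros on the curve and the line
   lambda = 0.  Each kernel vector w_0 of B' extends to a functional w of degree n
   with w lambda = w_0 and w(p) = 0, and the identity forces w(q) = 0 and w mu to
   be again a kernel vector.  Hence a combination tau of lambda and mu satisfies
   w tau = 0 for some such w <> 0, and functionals on the line tau = 0 that kill p
   and q contain an evaluation f |-> f(x) v, at a common zero x. *)

(** * Forms as functions and linear independence of monomials *)

Lemma sum_ord3 (V : nmodType) (F : 'I_3 -> V) :
  \sum_(k < 3) F k = F 0 + F 1 + F 2.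
Proof.
rewrite !big_ord_recl big_ord0 addr0 addrA.
by congr (F _ + F _ + F _); apply: val_inj.
Qed.

Section Monomials.
Variable C : numClosedFieldType.
Implicit Types (x y : 'I_3 -> C) (a : 'X_{1..3}) (p q : {mpoly C[3]}).

Definition monomial x a : C := \prod_(k < 3) x k ^+ a k.

Lemma monomial_succ n x (j : mindex n.-1) k :
  monomial x (mnm_of (mindex_succ j k)) = monomial x (mnm_of j) * x k.
Proof. exact: bzpowU. Qed.

Lemma poly_eval0 (P : {poly C}) : (forall t, P.[t] = 0) -> P = 0.
Proof.
move=> h; apply/eqP/negPn/negP => P0.
pose s : seq C := [seq i%:R | i <- iota 0 (size P)].
have us : uniq s.
  by rewrite map_inj_uniq ?iota_uniq // => i j /eqP; rewrite eqr_nat => /eqP.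
have rs : all (root P) s by apply/allP => t _; rewrite /root h.
by have := max_poly_roots P0 rs us; rewrite size_map size_iota ltnn.
Qed.

(* Kronecker substitution x_k := t ^ (N ^ k) with N above all the exponents. *)
Lemma monomial_indep (I : finType) (e : I -> 'X_{1..3}) (c : I -> C) :
  injective e -> (forall x, \sum_i c i * monomial x (e i) = 0) ->
  forall i, c i = 0.
Proof.
move=> einj h i.
pose N := (\sum_i mdeg (e i)).+1.
pose code a : nat := (\sum_(k < 3) a k * N ^ k)%N.
pose P : {poly C} := \sum_i c i *: 'X^(code (e i)).
have P0 : P = 0.
  apply: poly_eval0 => t; rewrite -[RHS](h (fun k => t ^+ (N ^ k))) horner_sum.
  apply: eq_bigr => l _; rewrite hornerZ hornerXn; congr (_ * _).
  rewrite /code -prodrXr.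
  by apply: eq_bigr => k _; rewrite mulnC exprM.
have ltN l (k : 'I_3) : (e l k < N)%N.
  rewrite ltnS (bigD1 l) //= mdegE (bigD1 k) //= -addnA; exact: leq_addr.
(* Uniqueness of base-N digits: the digits of [code a] are the three exponents. *)
have digit u v u' v' : (u < N -> u' < N -> u + N * v = u' + N * v' ->
    u = u' /\ v = v')%N.
  move=> uN u'N E; have N0 : (0 < N)%N by [].
  have Eu : u = u'.
    have := congr1 (modn^~ N) E.
    by rewrite ![(_ + N * _)%N]addnC ![(N * _)%N]mulnC !modnMDl !modn_small.
  by split=> //; move: E; rewrite Eu => /addnI/eqP; rewrite eqn_pmul2l // => /eqP.
have code_inj l l' : code (e l) = code (e l') -> l = l'.
  have codeE a : code a = (a 0%R + N * (a 1%R + N * a 2%R))%N.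
    rewrite mulnDr mulnA mulnn addnA /code !big_ord_recl big_ord0 addn0 addnA.
    rewrite expn0 muln1 [(N * _)%N]mulnC [(N ^ 2 * _)%N]mulnC.
    by congr (a _ + a _ * _ + a _ * _)%N; apply: val_inj.
  rewrite !codeE => E; have [E0 E'] := digit _ _ _ _ (ltN _ _) (ltN _ _) E.
  have [E1 E2] := digit _ _ _ _ (ltN _ _) (ltN _ _) E'.
  apply: einj; apply/mnmP => -[[|[|[|//]]] hk].
  - by rewrite (_ : Ordinal hk = 0%R) //; apply: val_inj.
  - by rewrite (_ : Ordinal hk = 1%R) //; apply: val_inj.
  - by rewrite (_ : Ordinal hk = 2%R) //; apply: val_inj.
have := congr1 (fun Q : {poly C} => Q`_(code (e i))) P0.
rewrite coef0 coef_sum (bigD1 i) //= big1 => [|l li].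
  by rewrite coefZ coefXn eqxx mulr1 addr0.
rewrite coefZ coefXn; case: eqP => [/code_inj E|_]; last by rewrite mulr0.
by rewrite E eqxx in li.
Qed.

Lemma mpoly_eval0 p : (forall x, p.@[x] = 0) -> p = 0.
Proof.
move=> h; have pE := mpolywE (leqnn (msize p)).
apply/mpolyP => a; rewrite mcoeff0.
have [/msize_mdeg_ge/memN_msupp_eq0-> //|lt] := leqP (msize p) (mdeg a).
apply: (@monomial_indep _ (fun i : 'X_{1..3 < msize p} => val i)
  (fun i => p@_i) val_inj _ (BMultinom lt)) => x.
transitivity p.@[x]; last exact: h.
rewrite [in RHS]pE raddf_sum /=; apply: eq_bigr => i _.
by rewrite mevalZ mevalX.
Qed.

Lemma mnm_of_inj n : injective (@mnm_of n).
Proof. by move=> i j E; do 2 apply: val_inj. Qed.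

(** The index set is [mindex n.+1] because this is the set of exponents of degree n. *)
Lemma homog_meval n p x : p \is n.-homog ->
  p.@[x] = \sum_(i : mindex n.+1) p@_(mnm_of i) * monomial x (mnm_of i).
Proof.
move=> hp; have le : (msize p <= n.+1)%N.
  by rewrite msizeE; apply/bigmax_leqP_seq => a /(dhomog_mf hp)-> _.
rewrite {1}(mpolywE le) raddf_sum /=.
transitivity (\sum_(i : 'X_{1..3 < n.+1} | (mdeg i).+1 == n.+1)
  p@_i * monomial x i).
  rewrite [RHS]big_mkcond; apply: eq_bigr => i _; rewrite mevalZ mevalX.
  case: ifP => // /negbT ne.
  by rewrite (dhomog_nemf_coeff hp) ?mul0r.
exact: big_sub.
Qed.
End Monomials.

(** * The Bezout identity for arbitrary functionals of bidegree (n, n) *)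

Section BezoutIdentity.
Variables (C : numClosedFieldType) (n : nat) (p q : {mpoly C[3]}).
Variables b10 b20 b12 : mindex n -> mindex n -> C.
Hypotheses (hp : p \is n.-homog) (hq : q \is n.-homog).
Hypothesis hb : bezout_coeffs p q b10 b20 b12.

Local Notation s j k := (@mindex_succ n.+1 j k).
Local Notation p_ i := (p@_(mnm_of i)).
Local Notation q_ i := (q@_(mnm_of i)).

(* The value on T of the right-hand side of the Bezout identity, where T is a
   linear functional on polynomials of bidegree (n, n) in (x, y). *)
Definition bezout_pairing (T : mindex n.+1 -> mindex n.+1 -> C) : C :=
  \sum_j \sum_j' (b10 j j' * (T (s j 1) (s j' 0) - T (s j 0) (s j' 1))
    + b20 j j' * (T (s j 2) (s j' 0) - T (s j 0) (s j' 2))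
    + b12 j j' * (T (s j 1) (s j' 2) - T (s j 2) (s j' 1))).

Lemma bezout_pairing_sum (I J : finType) (c : I -> J -> C) T :
  bezout_pairing (fun i i' => \sum_l \sum_l' c l l' * T l l' i i') =
  \sum_l \sum_l' c l l' * bezout_pairing (T l l').
Proof.
pose w (F : mindex n.+1 -> mindex n.+1 -> C) j j' :=
  (b10 j j' * (F (s j 1) (s j' 0) - F (s j 0) (s j' 1))
    + b20 j j' * (F (s j 2) (s j' 0) - F (s j 0) (s j' 2))
    + b12 j j' * (F (s j 1) (s j' 2) - F (s j 2) (s j' 1))).
transitivity (\sum_j \sum_j' \sum_l \sum_l' c l l' * w (T l l') j j').
  apply: eq_bigr => j _; apply: eq_bigr => j' _.
  rewrite -!sumrB !mulr_sumr -!big_split /=; apply: eq_bigr => l _.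
  rewrite -!sumrB !mulr_sumr -!big_split /=; apply: eq_bigr => l' _.
  by rewrite /w; ring.
under eq_bigr do rewrite exchange_big /=.
rewrite exchange_big /=; apply: eq_bigr => l _.
under eq_bigr do rewrite exchange_big /=.
rewrite exchange_big /=; apply: eq_bigr => l' _.
by rewrite mulr_sumr; apply: eq_bigr => j _; rewrite mulr_sumr.
Qed.

Lemma sum_delta (F : mindex n.+1 -> mindex n.+1 -> C) i i' :
  \sum_a \sum_b F a b * ((i == a) && (i' == b))%:R = F i i'.
Proof.
rewrite -[RHS](bzsum_delta i i' F); apply: eq_bigr => a _; apply: eq_bigr => b _.
by rewrite mulrC [i == a]eq_sym [i' == b]eq_sym.
Qed.

(** The defining identity only speaks of values at points; independence of the monomials in y and in
    x turns it into an identity of coefficients. *)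
Lemma bezout_coefficient (a b : mindex n.+1) :
  p_ a * q_ b - q_ a * p_ b = bezout_pairing (fun i i' => ((i == a) && (i' == b))%:R).
Proof.
pose delta (a b i i' : mindex n.+1) : C := ((i == a) && (i' == b))%:R.
pose d a b := p_ a * q_ b - q_ a * p_ b - bezout_pairing (delta a b).
suff d0 : d a b = 0 by apply/eqP; rewrite -subr_eq0 -/(d a b) d0.
have inj := @mnm_of_inj n.+1.
apply: (monomial_indep inj (c := fun b => d a b)) => y.
pose c a := \sum_b d a b * monomial y (mnm_of b).
apply: (monomial_indep inj (c := c)) => x.
pose mx := monomial x \o @mnm_of n.+1; pose my := monomial y \o @mnm_of n.+1.
have mE i i' : mx i * my i' = \sum_a \sum_b (mx a * my b) * delta a b i i'.
  by rewrite /delta sum_delta.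
have bE : bezout_pairing (fun i i' => mx i * my i') =
    \sum_a \sum_b mx a * my b * bezout_pairing (delta a b).
  rewrite -bezout_pairing_sum /bezout_pairing.
  by apply: eq_bigr => j _; apply: eq_bigr => j' _; rewrite !mE.
transitivity (p.@[x] * q.@[y] - q.@[x] * p.@[y]
  - bezout_pairing (fun i i' => mx i * my i')).
  rewrite bE !(homog_meval _ hp) !(homog_meval _ hq) !mulr_suml -!sumrB.
  apply: eq_bigr => i _; rewrite !mulr_sumr mulr_suml -!sumrB.
  apply: eq_bigr => i' _; rewrite /d /mx /my /=; ring.
case: hb => _ _ _ /(_ x y)/= ->; rewrite -sumrB; apply: big1 => j _.
rewrite -sumrB; apply: big1 => j' _.
rewrite /mx /my /= !(@monomial_succ C n.+1) /monomial; ring.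
Qed.

(** Both sides are linear in [T], so the coordinate functionals suffice. *)
Lemma bezout_bilinear (T : mindex n.+1 -> mindex n.+1 -> C) :
  \sum_i \sum_i' (p_ i * q_ i' - q_ i * p_ i') * T i i' = bezout_pairing T.
Proof.
under eq_bigr do under eq_bigr do rewrite bezout_coefficient mulrC.
rewrite -bezout_pairing_sum /bezout_pairing.
by apply: eq_bigr => j _; apply: eq_bigr => j' _; rewrite !sum_delta.
Qed.
End BezoutIdentity.

(** * Vector-valued functionals on forms *)

Section Functionals.
Variables (C : numClosedFieldType) (m : nat).
Implicit Types (D : 'I_3 -> 'M[C]_m) (x l : 'I_3 -> C) (p q : {mpoly C[3]}).

Local Notation s j k := (@mindex_succ _.+1 j k).

(* An element w of [blown n.+1] is read as the C^m-valued functional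
   x^i |-> w_i on forms of degree n; [contract l w] is then f |-> w (l f) for
   the linear form with coefficients l, and [applyf p w] is w (p). *)
Definition contract n l (w : blown C m n.+1) : blown C m n :=
  [ffun j => \sum_(k < 3) l k *: w (s j k)].

Definition applyf n p (w : blown C m n) : 'cV[C]_m :=
  \sum_i p@_(mnm_of i) *: w i.

Definition lmul n (A : 'M[C]_m) (w : blown C m n) : blown C m n :=
  [ffun i => A *m w i].

Definition point_functional n x (v : 'cV[C]_m) : blown C m n :=
  [ffun i => monomial x (mnm_of i) *: v].

Definition pencil D x : 'M[C]_m := \sum_(k < 3) x k *: D k.

Lemma contract_linear n l : linear (@contract n l).
Proof.
move=> a v w; apply/ffunP => j; rewrite !ffunE scaler_sumr -big_split /=.
by apply: eq_bigr => k _; rewrite !ffunE scalerDr !scalerA mulrC.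
Qed.

HB.instance Definition _ n l :=
  GRing.isSemilinear.Build C (blown C m n.+1) (blown C m n) _ (@contract n l)
    (GRing.semilinear_linear (@contract_linear n l)).

Lemma applyf_linear n p : linear (@applyf n p).
Proof.
move=> a v w; rewrite /applyf scaler_sumr -big_split /=.
by apply: eq_bigr => k _; rewrite !ffunE scalerDr !scalerA mulrC.
Qed.

HB.instance Definition _ n p :=
  GRing.isSemilinear.Build C (blown C m n) 'cV[C]_m _ (@applyf n p)
    (GRing.semilinear_linear (@applyf_linear n p)).

Lemma lmul_linear n A : linear (@lmul n A).
Proof.
move=> a v w; apply/ffunP => j; rewrite !ffunE mulmxDr -scalemxAr //.
Qed.

HB.instance Definition _ n A :=
  GRing.isSemilinear.Build C (blown C m n) (blown C m n) _ (@lmul n A)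
    (GRing.semilinear_linear (@lmul_linear n A)).

Lemma contract_lmul n l A (w : blown C m n.+1) :
  contract l (lmul A w) = lmul A (contract l w).
Proof.
apply/ffunP => j; rewrite !ffunE mulmx_sumr; apply: eq_bigr => k _.
by rewrite ffunE scalemxAr.
Qed.

Lemma applyf_lmul n p A (w : blown C m n) : applyf p (lmul A w) = A *m applyf p w.
Proof.
rewrite /applyf mulmx_sumr; apply: eq_bigr => i _.
by rewrite ffunE scalemxAr.
Qed.

Lemma mindex_succC n (j : mindex n) (k l : 'I_3) :
  @mindex_succ n.+2 (@mindex_succ n.+1 j k) l =
  @mindex_succ n.+2 (@mindex_succ n.+1 j l) k.
Proof. by apply: mnm_of_inj; apply/mnmP => i; rewrite !mnmDE addnAC. Qed.

Lemma contractC n l l' (w : blown C m n.+2) :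
  contract l (contract l' w) = contract l' (contract l w).
Proof.
apply/ffunP => j; rewrite !ffunE.
under eq_bigr do rewrite ffunE scaler_sumr.
under [RHS]eq_bigr do rewrite ffunE scaler_sumr.
rewrite exchange_big; apply: eq_bigr => k _; apply: eq_bigr => k' _.
by rewrite mindex_succC !scalerA mulrC.
Qed.

Lemma contractD n (a b : C) l l' (w : blown C m n.+1) :
  contract (fun k => a * l k + b * l' k) w = a *: contract l w + b *: contract l' w.
Proof.
apply/ffunP => j; rewrite !ffunE !scaler_sumr -big_split; apply: eq_bigr => k _.
by rewrite scalerDl !scalerA.
Qed.

Lemma contract_principal n D l (w : blown C m n.+1) :
  w \in principal n.+1 D -> contract l w \in principal n D.
Proof.
(* For n = 0 the truncated [n.-1] is again 0, and [mindex 0] is empty. *)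
case: n w => [|n] w /principalP h; apply/principalP => j.
  by have := mnm_ofP j.
rewrite /= in j *; under eq_bigr do rewrite ffunE mulmx_sumr.
rewrite exchange_big big1 //= => k _.
transitivity (l k *: (\sum_(k' < 3) D k' *m w (s (s j k) k'))).
  rewrite scaler_sumr; apply: eq_bigr => k' _.
  by rewrite mindex_succC scalemxAr.
by rewrite (h (s j k)) scaler0.
Qed.

Lemma point_functional_principal n D x v :
  pencil D x *m v = 0 -> point_functional n x v \in principal n D.
Proof.
move=> h; apply/principalP => j.
transitivity (monomial x (mnm_of j) *: (pencil D x *m v)); last by rewrite h scaler0.
rewrite /pencil mulmx_suml scaler_sumr; apply: eq_bigr => k _.
by rewrite ffunE monomial_succ -scalemxAr -scalemxAl scalerA.
Qed.

Lemma contract_point n x v l :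
  contract l (point_functional n.+1 x v) =
  (\sum_(k < 3) l k * x k) *: point_functional n x v.
Proof.
apply/ffunP => j; rewrite !ffunE scalerA mulr_suml scaler_suml; apply: eq_bigr => k _.
by rewrite ffunE monomial_succ scalerA -mulrA [x k * _]mulrC.
Qed.

Lemma applyf_point n p x v : p \is n.-homog ->
  applyf p (point_functional n.+1 x v) = p.@[x] *: v.
Proof.
move=> hp; rewrite (homog_meval _ hp) scaler_suml; apply: eq_bigr => i _.
by rewrite ffunE scalerA.
Qed.

(** The k-th coordinate as a linear form; contraction by it is the index shift. *)
Definition delta3 (k : 'I_3) : 'I_3 -> C := fun i => (i == k)%:R.

Lemma contract_delta3 n k (w : blown C m n.+1) j :
  contract (delta3 k) w j = w (s j k).
Proof.
rewrite ffunE (bigD1 k) //= big1 ?addr0 /delta3 ?eqxx ?scale1r // => l lk.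
by rewrite (negPf lk) scale0r.
Qed.

Lemma mindex_pred n (i : mindex n.+2) : exists j k, i = @mindex_succ n.+2 j k.
Proof.
have [k hk] : exists k, (0 < mnm_of i k)%N.
  apply/existsP; apply: contra_eqT (mnm_ofP i) => /existsPn h.
  rewrite mdegE big1 // => k _; apply/eqP; rewrite -leqn0 leqNgt; exact: h.
have le : (U_(k) <= mnm_of i)%MM.
  by apply/mnm_lepP => l; rewrite mnm1E; case: eqP => // <-.
have dj : (mdeg (mnm_of i - U_(k))%MM).+1 == n.+1.
  by rewrite -eqSS -{2}(mnm_ofP i) -{2}(submK le) mdegD mdeg1 addn1.
exists (mk_mindex dj), k; apply: mnm_of_inj.
by rewrite /mnm_of /= submK.
Qed.

(** In the argument of [w] the k-th coordinate may be replaced by the number [x k] times [l]. By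
    induction on the degree [contract l w] is an evaluation at [x]; splitting one variable off each
    monomial carries this over to [w]. *)
Lemma point_functionalP n x l (w : blown C m n.+1) :
  (forall k, contract (delta3 k) w = x k *: contract l w) ->
  exists v, w = point_functional n.+1 x v.
Proof.
elim: n w => [|n IH] w h.
  have d0 : (mdeg (0%MM : 'X_{1..3})).+1 == 1%N by rewrite mdeg0.
  exists (w (mk_mindex d0)); apply/ffunP => i; rewrite ffunE.
  have -> : i = mk_mindex d0.
    apply: mnm_of_inj; apply/eqP; rewrite -[mnm_of (mk_mindex d0)]/0%MM -mdeg_eq0.
    by have [->] := mnm_ofP i.
  by rewrite /monomial big1 ?scale1r // => k _; rewrite mnm0E expr0.
have [k|v E] := IH (contract l w).
  by rewrite contractC h linearZ.
exists v; apply/ffunP => i; have [j [k ->]] := mindex_pred i.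
rewrite -contract_delta3 h E !ffunE monomial_succ scalerA.
by rewrite mulrC.
Qed.
End Functionals.

(** * Determinants, eigenvectors and singular pencils *)

Section LinearAlgebra.

Lemma lfun_det_eq0 (K : fieldType) (vT : vectType K) (f : 'End(vT)) :
  lfun_det f = 0 <-> exists2 v, v != 0 & f v = 0.
Proof.
have eB := vbasisP {:vT}; set e := vbasis {:vT} in eB.
have f0 v : (f v == 0) = (passmx.rVof e v *m passmx.mxof e e f == 0).
  by rewrite -passmx.rVof_app // passmx.rVof_eq0.
split=> [/eqP/det0P[u u0 uM] | [v v0 /eqP fv]].
  exists (passmx.vecof e u); first by rewrite passmx.vecof_eq0.
  by apply/eqP; rewrite f0 passmx.vecofK // uM.
by apply/eqP/det0P; exists (passmx.rVof e v); [rewrite passmx.rVof_eq0 | apply/eqP; rewrite -f0].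
Qed.

Variable C : numClosedFieldType.

Lemma eigenvector_exists (vT : vectType C) (f : 'End(vT)) :
  (0 < dim vT)%N -> exists c v, v != 0 /\ f v = c *: v.
Proof.
move=> d0; have eB := vbasisP {:vT}; set e := vbasis {:vT} in eB.
have [|c /eigenvalueP[u uM u0]] := spectral.eigenvalue_closed (passmx.mxof e e f).
  by rewrite dimvf.
exists c, (passmx.vecof e u); rewrite passmx.vecof_eq0 //; split=> //.
rewrite (passmx.hom_vecof e eB) uM /passmx.vecof scaler_sumr.
by apply: eq_bigr => i _; rewrite mxE scalerA.
Qed.

(* When f is injective on U, so that f @: U = V, take an eigenvector of the
   endomorphism f^-1 g of U. *)
Lemma singular_pencil (aT rT : vectType C) (f g : 'Hom(aT, rT))
    (U : {vspace aT}) (V : {vspace rT}) :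
  U != 0%VS -> (\dim V <= \dim U)%N -> (f @: U <= V)%VS -> (g @: U <= V)%VS ->
  exists s1 s2 u, [/\ (s1 != 0) || (s2 != 0), u \in U, u != 0 &
    s1 *: f u + s2 *: g u = 0].
Proof.
move=> U0 dVU fU gU.
have [capU|] := eqVneq (U :&: lker f)%VS 0%VS; last first.
  rewrite -vpick0 => u0.
  have := memv_pick (U :&: lker f)%VS; rewrite memv_cap memv_ker => /andP[uU /eqP fu].
  exists 1, 0, (vpick (U :&: lker f)%VS); rewrite oner_eq0 u0 uU fu.
  by rewrite scale0r scaler0 addr0.
have fUV : (f @: U)%VS = V.
  by apply/eqP; rewrite eqEdim fU (limg_dim_eq capU).
pose f' := (f \o linfun (@vsval _ _ U))%VF; pose g' := (g \o linfun (@vsval _ _ U))%VF.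
have f'E u : f' u = f (vsval u) by rewrite comp_lfunE lfunE.
have g'E u : g' u = g (vsval u) by rewrite comp_lfunE lfunE.
have kf' : lker f' == 0%VS.
  rewrite -subv0; apply/subvP => u; rewrite memv_ker f'E memv0 => fu.
  have : vsval u \in (U :&: lker f)%VS by rewrite memv_cap subvsP memv_ker.
  by rewrite capU memv0 => /eqP u0; apply/eqP/val_inj.
have d0 : (0 < dim (subvs_of U))%N.
  by rewrite lt0n; apply: contraNneq U0 => U0; rewrite -dimv_eq0; apply/eqP.
have [c [u [u0 hu]]] := eigenvector_exists (f'^-1 \o g')%VF d0.
have gu : g' u \in limg f'.
  have : g (vsval u) \in (f @: U)%VS.
    by rewrite fUV; apply: subvP gU _ _; rewrite memv_img ?subvsP.
  case/memv_imgP => a aU ga; apply/memv_imgP; exists (vsproj U a); rewrite ?memvf //.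
  by rewrite g'E f'E vsprojK.
exists (- c), 1, (vsval u); rewrite oner_eq0 orbT subvsP; split=> //.
rewrite scale1r -f'E -g'E -(limg_lfunVK gu).
rewrite comp_lfunE in hu; rewrite hu linearZ scaleNr addNr //.
Qed.

(** The pencil of [f] and the identity is singular on [U]; the coefficient of [f] is nonzero because
    the identity is injective. *)
Lemma stable_eigenvector (vT : vectType C) (f : 'End(vT)) (U : {vspace vT}) :
  U != 0%VS -> (f @: U <= U)%VS -> exists c v, [/\ v \in U, v != 0 & f v = c *: v].
Proof.
move=> U0 fU.
have [|s1 [s2 [u [s0 uU u0 E]]]] := singular_pencil U0 (leqnn _) fU (_ : \1%VF @: U <= U)%VS.
  by rewrite lim1g.
rewrite id_lfunE in E.
have s10 : s1 != 0.
  apply: contraTneq s0 => s10; move: E; rewrite s10 scale0r add0r eqxx /=.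
  by move=> /eqP; rewrite scaler_eq0 (negPf u0) orbF negbK.
exists (- (s1^-1 * s2)), u; split=> //.
apply: (scalerI s10); apply/eqP; rewrite -subr_eq0 scalerA mulrN mulrA.
by rewrite divff // mul1r scaleNr opprK E.
Qed.
End LinearAlgebra.

(** * Principal functionals on a line through z *)

Section Restriction.
Variables (C : numClosedFieldType) (m : nat) (z : 'I_3 -> C).
Hypothesis z2 : z 2 = 1.

(** This is s1 lambda + s2 mu; since z_2 = 1, these are all the linear forms vanishing at z. *)
Definition form s1 s2 : 'I_3 -> C := fun k =>
  if k == 0 then s1 else if k == 1 then s2 else - (s1 * z 0 + s2 * z 1).

(** The point (s2, -s1, 0) + e z. For (s1, s2) nonzero these are the points other than z of the line
    where [form s1 s2] vanishes. *)
Definition line_point s1 s2 e : 'I_3 -> C := fun k =>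
  (if k == 0 then s2 else if k == 1 then - s1 else 0) + z k * e.

Lemma ord3_ind (P : 'I_3 -> Prop) : P 0 -> P 1 -> P 2 -> forall k, P k.
Proof.
move=> P0 P1 P2 [[|[|[|//]]] hk].
- by rewrite (_ : Ordinal hk = 0) //; apply: val_inj.
- by rewrite (_ : Ordinal hk = 1) //; apply: val_inj.
- by rewrite (_ : Ordinal hk = 2) //; apply: val_inj.
Qed.

Lemma form_line_point t1 t2 s1 s2 e :
  \sum_(k < 3) form t1 t2 k * line_point s1 s2 e k = t1 * s2 - t2 * s1.
Proof. by rewrite sum_ord3 /form /line_point /= z2; ring. Qed.

Lemma form_complement (s1 s2 : C) : (s1 != 0) || (s2 != 0) ->
  exists t1 t2, t1 * s2 - t2 * s1 = 1.
Proof.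
case: (eqVneq s1 0) => [-> /= s20 | s10 _].
  by exists (s2^-1), 0; rewrite mulVf // mulr0 subr0.
by exists 0, (- s1^-1); rewrite mul0r sub0r mulNr opprK mulVf.
Qed.

Lemma line_point_neq0 s1 s2 e : (s1 != 0) || (s2 != 0) ->
  exists k, line_point s1 s2 e k != 0.
Proof.
move=> /form_complement[t1 [t2 E]].
apply/(existsP (P := fun k => line_point s1 s2 e k != 0)); apply: contraT => /existsPn h.
have := form_line_point t1 t2 s1 s2 e.
rewrite big1 => [|k _]; first by rewrite E => /esym/eqP; rewrite oner_eq0.
by have /eqP-> := negbNE (h k); rewrite mulr0.
Qed.

(** At a = (s2, -s1, 0) and z the form [form t1 t2] takes the values 1 and 0, and x_2 the values 0
    and 1. Hence x_k - a_k [form t1 t2] - z_k x_2 vanishes on the line through a and z, so it is a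
    multiple of [form s1 s2]. *)
Lemma delta3_decomp s1 s2 t1 t2 (h : t1 * s2 - t2 * s1 = 1) k :
  exists c, forall i, delta3 C k i =
    line_point s1 s2 0 k * form t1 t2 i + z k * delta3 C 2 i + c * form s1 s2 i.
Proof.
have by_h K (u v : C) : u - v = K * (1 - (t1 * s2 - t2 * s1)) -> u = v.
  by rewrite h subrr mulr0 => /eqP; rewrite subr_eq0 => /eqP.
elim/ord3_ind: k; rewrite /line_point /= ?z2.
- exists (- t2); apply: ord3_ind; rewrite /form /delta3 /=.
  + by apply: (by_h 1); ring.
  + by ring.
  + by apply: (by_h (- z 0)); ring.
- exists t1; apply: ord3_ind; rewrite /form /delta3 /=.
  + by ring.
  + by apply: (by_h 1); ring.
  + by apply: (by_h (- z 1)); ring.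
- by exists 0; apply: ord3_ind; rewrite /form /delta3 /=; ring.
Qed.

Variable D : 'I_3 -> 'M[C]_m.
Hypothesis Uz : pencil D z \in unitmx.

Section Line.
Variables (s1 s2 : C).
Hypothesis s0 : (s1 != 0) || (s2 != 0).

Let a := line_point s1 s2 0.
(** Chosen so that L v = e v is equivalent to U(a + e z) v = 0. *)
Let L := - (invmx (pencil D z) *m pencil D a).

Let UzL : pencil D z *m L = - pencil D a.
Proof. by rewrite mulmxN mulKVmx. Qed.

Lemma pencil_line_point e : pencil D (line_point s1 s2 e) = pencil D a + e *: pencil D z.
Proof.
rewrite /pencil scaler_sumr -big_split; apply: eq_bigr => k _ /=.
by rewrite scalerA -scalerDl /a /line_point mulr0 addr0 [e * _]mulrC.
Qed.

Lemma pencil_sum n x y (w1 w2 : blown C m n) j :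
  \sum_(k < 3) D k *m (x k *: w1 j + y k *: w2 j) =
  pencil D x *m w1 j + pencil D y *m w2 j.
Proof.
rewrite /pencil !mulmx_suml -big_split; apply: eq_bigr => k _ /=.
by rewrite mulmxDr -!scalemxAr -!scalemxAl.
Qed.

(* On functionals killed by [form s1 s2], multiplying the argument by x_k
   amounts to applying a_k + z_k L to the contraction by a complementary form. *)
Lemma shift_on_line n (w : blown C m n.+1) t1 t2 :
  t1 * s2 - t2 * s1 = 1 -> w \in principal n.+1 D -> contract (form s1 s2) w = 0 ->
  forall j k, w (@mindex_succ n.+1 j k) =
    a k *: contract (form t1 t2) w j + z k *: (L *m contract (form t1 t2) w j).
Proof.
move=> ht /principalP Vw tw.
pose psi := contract (form t1 t2) w; pose rho := contract (delta3 C 2) w.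
have E j k : w (@mindex_succ n.+1 j k) = a k *: psi j + z k *: rho j.
  rewrite -contract_delta3; have [c hc] := delta3_decomp ht k.
  transitivity ((a k *: psi + z k *: rho + c *: contract (form s1 s2) w) j).
    rewrite /psi /rho !ffunE !scaler_sumr -!big_split; apply: eq_bigr => i _ /=.
    by rewrite !scalerA -!scalerDl hc.
  by rewrite tw scaler0 addr0 !ffunE.
move=> j k; rewrite E; congr (_ + _ *: _).
have := Vw j; rewrite (eq_bigr (fun k => D k *m (a k *: psi j + z k *: rho j))).
  rewrite pencil_sum => /eqP; rewrite addrC addr_eq0 => /eqP h.
  by rewrite -[rho j](mulKmx Uz) h mulmxN mulNmx mulmxA.
by move=> i _; rewrite E.
Qed.

(** [Y] is stable under L and so contains an eigenvector, with eigenvalue e say. On it each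
    coordinate acts as a_k + e z_k times the complementary contraction, which makes it an evaluation
    at a + e z. *)
Lemma point_functional_exists n (Y : {vspace blown C m n.+1}) :
  Y != 0%VS -> {in Y, forall w, w \in principal n.+1 D} ->
  {in Y, forall w, contract (form s1 s2) w = 0} ->
  (forall A w, w \in Y -> lmul A w \in principal n.+1 D ->
    contract (form s1 s2) (lmul A w) = 0 -> lmul A w \in Y) ->
  exists e v, [/\ v != 0, pencil D (line_point s1 s2 e) *m v = 0 &
    point_functional n.+1 (line_point s1 s2 e) v \in Y].
Proof.
move=> Y0 YV Yt YA; have [t1 [t2 ht]] := form_complement s0.
have stab : (linfun (@lmul C m n.+1 L) @: Y <= Y)%VS.
  apply/subvP => _ /memv_imgP[w wY ->]; rewrite lfunE /=.
  apply: YA => //; last first.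
    rewrite contract_lmul Yt //; apply/ffunP => j.
    by rewrite !ffunE mulmx0.
  pose psi := lmul L (contract (form t1 t2) w).
  (* By [shift_on_line] the condition reads U(a) psi + U(z) L psi = 0, true as U(z) L = - U(a). *)
  apply/principalP => j; have E := shift_on_line ht (YV w wY) (Yt w wY).
  rewrite (eq_bigr (fun k => D k *m (a k *: psi j + z k *: lmul L psi j))).
    by rewrite pencil_sum !ffunE 2!mulmxA UzL mulNmx mulmxA subrr.
  by move=> k _; rewrite ffunE E !ffunE mulmxDr -!scalemxAr.
have [e [w [wY w0]]] := stable_eigenvector Y0 stab; rewrite lfunE /= => Lw.
have := @point_functionalP C m n (line_point s1 s2 e) (form t1 t2) w.
case=> [k | v wE].
  apply/ffunP => j; rewrite contract_delta3.
  rewrite (shift_on_line ht (YV w wY) (Yt w wY)).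
  have -> : L *m contract (form t1 t2) w j = e *: contract (form t1 t2) w j.
    have := congr1 (fun u => contract (form t1 t2) u j) Lw.
    by rewrite contract_lmul linearZ /= !ffunE.
  by rewrite [RHS]ffunE scalerA -scalerDl /a /line_point mulr0 addr0.
have [i wi] : exists i, w i != 0.
  apply/existsP; apply: contraNT w0 => /existsPn h; apply/eqP/ffunP => i.
  by rewrite ffunE; apply/eqP/negbNE/h.
move: (wi); rewrite wE ffunE scaler_eq0 negb_or => /andP[mi v0].
exists e, v; split=> //; last by rewrite -wE.
have Lv : L *m v = e *: v.
  have := congr1 (fun u : blown C m n.+1 => u i) Lw.
  by rewrite /= wE !ffunE -scalemxAr scalerA mulrC -scalerA => /(scalerI mi).
by rewrite pencil_line_point mulmxDl -scalemxAl scalemxAr -Lv mulmxA UzL mulNmx subrr.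
Qed.
End Line.
End Restriction.

(** * Dimension of the principal subspace and surjectivity of contractions *)

Lemma card_mindexS n : (#|{: mindex n}| + n.+1 <= #|{: mindex n.+1}|)%N.
Proof.
(* Degree n contains x_2 times degree n - 1 and, disjointly, the monomials x_0^k x_1^(n-k) for k <=
   n. *)
pose f (u : mindex n + 'I_n.+1) : 'X_{1..3} := match u with
  | inl j => (mnm_of j + U_(2))%MM
  | inr k => [multinom nth 0%N [:: k : nat; n - k; 0]%N i | i < 3] end.
have df u : (mdeg (f u)).+1 == n.+1.
  case: u => [j | k] /=; first exact: (@mindex_succP n.+1 j 2).
  rewrite mdegE sum_ord3 !mnmE /=.
  by change ((k + (n - k) + 0).+1 == n.+1)%N; rewrite addn0 subnKC // -ltnS ltn_ord.
have f_inj : injective (fun u => mk_mindex (df u)).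
  move=> u v /(congr1 (@mnm_of _)); rewrite /mnm_of /=.
  case: u v => [j | k] [j' | k'] /mnmP E /=.
  - congr inl; apply: mnm_of_inj; apply/mnmP => i.
    by have := E i; rewrite !mnmDE => /addIn.
  - by have := E 2; rewrite mnmDE mnm1E mnmE /= addn1.
  - by have := E 2; rewrite mnmDE mnm1E mnmE /= addn1.
  - by congr inr; apply: val_inj; have := E 0; rewrite !mnmE.
have := leq_card _ f_inj; rewrite card_sum card_ord; exact.
Qed.

Section Surjectivity.
Variables (C : numClosedFieldType) (m : nat) (z : 'I_3 -> C).
Hypothesis z2 : z 2 = 1.
Variable D : 'I_3 -> 'M[C]_m.
Hypothesis Uz : pencil D z \in unitmx.

(** A kernel vector [v] witnesses that the point lies on the curve; the missing point z of the line
    is off the curve because [pencil D z] is invertible. *)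
Definition nonvanishing_on_line s1 s2 (p : {mpoly C[3]}) := forall e (v : 'cV[C]_m),
  v != 0 -> pencil D (line_point z s1 s2 e) *m v = 0 -> p.@[line_point z s1 s2 e] != 0.

(** Otherwise the space of such functionals contains an evaluation at a point of the curve on the
    line, whose value at p is nonzero. *)
Lemma applyf_inj_on_line s1 s2 n p (w : blown C m n.+1) :
  (s1 != 0) || (s2 != 0) -> p \is n.-homog -> nonvanishing_on_line s1 s2 p ->
  w \in principal n.+1 D -> contract (form z s1 s2) w = 0 -> applyf p w = 0 ->
  w = 0.
Proof.
move=> s0 hp pn wV wt wp.
pose Y := (principal n.+1 D :&: (lker (linfun (@contract C m n (form z s1 s2))) :&:
  lker (linfun (@applyf C m n.+1 p))))%VS.
have YP u : reflect [/\ u \in principal n.+1 D, contract (form z s1 s2) u = 0 &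
    applyf p u = 0] (u \in Y).
  rewrite !memv_cap !memv_ker !lfunE /=.
  by apply: (iffP and3P) => [[? /eqP ? /eqP ?] | [? -> ->]].
have [Y0|Y0] := eqVneq Y 0%VS.
  by apply/eqP; rewrite -memv0 -Y0; apply/YP.
have [|||e [v [v0 xv /YP[_ _]]]] := point_functional_exists z2 Uz s0 Y0.
- by move=> u /YP[].
- by move=> u /YP[].
- by move=> A u /YP[uV ut up] AV At; apply/YP; split; rewrite // applyf_lmul up mulmx0.
rewrite applyf_point // => /eqP; rewrite scaler_eq0 (negPf v0) orbF.
by rewrite (negPf (pn e v v0 xv)).
Qed.

(** The complementary form equals 1 at every [line_point], so its powers are nonvanishing forms of
    any degree. *)
Lemma form_power_nonvanishing s1 s2 t1 t2 n : t1 * s2 - t2 * s1 = 1 ->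
  nonvanishing_on_line s1 s2 ((\sum_(k < 3) form z t1 t2 k *: 'X_k) ^+ n).
Proof.
move=> ht e v _ _; rewrite rmorphXn /= raddf_sum /=.
under eq_bigr do rewrite mevalZ mevalXU.
by rewrite form_line_point // ht expr1n oner_neq0.
Qed.

Lemma form_power_homog (l : 'I_3 -> C) n :
  (\sum_(k < 3) l k *: 'X_k) ^+ n \is n.-homog.
Proof.
rewrite -[X in X.-homog]mul1n; apply: dhomogMn; apply: rpred_sum => k _.
by apply: dhomogZ; rewrite dhomogX /= mdeg1.
Qed.

Let K s1 s2 n := (principal n.+1 D :&: lker (linfun (@contract C m n (form z s1 s2))))%VS.

Lemma contract_img s1 s2 n :
  (linfun (@contract C m n (form z s1 s2)) @: principal n.+1 D <= principal n D)%VS.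
Proof.
by apply/subvP => _ /memv_imgP[w wV ->]; rewrite lfunE; apply: contract_principal.
Qed.

Lemma applyf_kernel0 s1 s2 n p : (s1 != 0) || (s2 != 0) -> p \is n.-homog ->
  nonvanishing_on_line s1 s2 p -> (K s1 s2 n :&: lker (linfun (@applyf C m n.+1 p)))%VS = 0%VS.
Proof.
move=> s0 hp pn; apply/eqP; rewrite -subv0; apply/subvP => w.
rewrite 2!memv_cap -andbA => /and3P[wV]; rewrite !memv_ker !lfunE => /eqP wt /eqP wp.
by rewrite (applyf_inj_on_line s0 hp pn wV wt wp) mem0v.
Qed.

(** The value at a power of the complementary form embeds the kernel into C^m. *)
Lemma dim_kernel_le s1 s2 n : (s1 != 0) || (s2 != 0) -> (\dim (K s1 s2 n) <= m)%N.
Proof.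
move=> s0; have [t1 [t2 ht]] := form_complement s0.
rewrite -(limg_dim_eq (applyf_kernel0 s0 (form_power_homog _ n)
  (form_power_nonvanishing n ht))).
by rewrite (leq_trans (dimvS (subvf _))) // dimvf dim_matrix mulr1.
Qed.

(** Number of unknowns minus number of equations. *)
Lemma dim_principal_ge n : (n.+1 * m <= \dim (principal n.+1 D))%N.
Proof.
have := limg_ker_dim (linfun (@principal_map C m n.+1 D)) fullv.
rewrite capfv -/(principal n.+1 D) dimvf => E.
have : (\dim (limg (linfun (@principal_map C m n.+1 D))) <= #|{: mindex n}| * m)%N.
  rewrite (leq_trans (dimvS (subvf _))) // dimvf.
  by rewrite [dim _](_ : _ = #|{: mindex n}| * (m * 1))%N // muln1.
move: E; rewrite [dim _](_ : _ = #|{: mindex n.+1}| * (m * 1))%N // muln1 => E le.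
have := leq_mul (card_mindexS n) (leqnn m); rewrite -E mulnDl => h.
by have := leq_trans h (leq_add (leqnn _) le); rewrite addnC leq_add2r.
Qed.

Lemma dim_principal n : \dim (principal n D) = (n * m)%N.
Proof.
have s0 : ((1 : C) != 0) || ((0 : C) != 0) by rewrite oner_neq0.
elim: n => [|n IH].
  apply/eqP; rewrite mul0n dimv_eq0 -subv0; apply/subvP => w _; rewrite memv0.
  by apply/eqP/ffunP => i; have := mnm_ofP i.
apply/eqP; rewrite eqn_leq dim_principal_ge andbT.
rewrite -(limg_ker_dim (linfun (@contract C m n (form z 1 0)))) mulSn leq_add //.
  exact: dim_kernel_le.
by rewrite -IH dimvS // contract_img.
Qed.

(** The dimensions m and n m bound kernel and image from above and add up to the dimension of the
    source, so both bounds are attained. *)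
Lemma dim_contract_img s1 s2 n : (s1 != 0) || (s2 != 0) ->
  (linfun (@contract C m n (form z s1 s2)) @: principal n.+1 D = principal n D)%VS
  /\ \dim (K s1 s2 n) = m.
Proof.
move=> s0.
have E := limg_ker_dim (linfun (@contract C m n (form z s1 s2))) (principal n.+1 D).
have le1 := dim_kernel_le n s0; have le2 := dimvS (contract_img s1 s2 n).
rewrite !dim_principal // -/(K s1 s2 n) in E le2.
have arith (a b c d : nat) : (a + b = c + d -> a <= c -> b <= d -> a = c /\ b = d)%N.
  by lia.
rewrite mulSn in E; have [-> E2] := arith _ _ _ _ E le1 le2.
by split=> //; apply/eqP; rewrite eqEdim contract_img dim_principal E2 leqnn.
Qed.

Lemma contract_surj s1 s2 n w : (s1 != 0) || (s2 != 0) -> w \in principal n D ->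
  exists2 u, u \in principal n.+1 D & contract (form z s1 s2) u = w.
Proof.
move=> s0; have [<- _] := dim_contract_img n s0.
by case/memv_imgP => u uV ->; exists u; rewrite ?lfunE.
Qed.

(** On the kernel of the contraction, of dimension m, the value at p is injective into C^m, hence
    bijective; it corrects the value of any lift. *)
Lemma contract_applyf_surj s1 s2 n p w c : (s1 != 0) || (s2 != 0) ->
  p \is n.-homog -> nonvanishing_on_line s1 s2 p -> w \in principal n D ->
  exists u, [/\ u \in principal n.+1 D, contract (form z s1 s2) u = w &
    applyf p u = c].
Proof.
move=> s0 hp pn wV; have [u uV uw] := contract_surj s0 wV.
have img : (linfun (@applyf C m n.+1 p) @: K s1 s2 n = fullv)%VS.
  apply/eqP; rewrite eqEdim subvf /= (limg_dim_eq (applyf_kernel0 s0 hp pn)).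
  by have [_ ->] := dim_contract_img n s0; rewrite dimvf dim_matrix mulr1.
have : c - applyf p u \in (linfun (@applyf C m n.+1 p) @: K s1 s2 n)%VS.
  by rewrite img memvf.
case/memv_imgP => k; rewrite memv_cap => /andP[kV]; rewrite memv_ker !lfunE /= => /eqP kt E.
exists (k + u); rewrite memvD // !linearD /= kt add0r uw; split=> //.
by rewrite -E subrK.
Qed.
End Surjectivity.

(** * The bilinear form of the Bezout matrix *)

Section BilinearIdentity.
Variables (C : numClosedFieldType) (m n : nat) (D : 'I_3 -> 'M[C]_m).
Variables (p q : {mpoly C[3]}) (b10 b20 b12 : mindex n -> mindex n -> C).

Local Notation s j k := (@mindex_succ n.+1 j k).

(** Bilinear, without conjugation, so the left argument is governed by the transposes of the D_k. *)
Definition mx_form (u : 'cV[C]_m) (A : 'M[C]_m) (v : 'cV[C]_m) : C :=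
  (u^T *m A *m v) 0 0.

Lemma mx_form_suml (I : finType) (l : I -> C) (u : I -> 'cV_m) A v :
  mx_form (\sum_i l i *: u i) A v = \sum_i l i * mx_form (u i) A v.
Proof.
rewrite /mx_form raddf_sum !mulmx_suml summxE; apply: eq_bigr => i _.
by rewrite /= linearZ /= -!scalemxAl mxE.
Qed.

Lemma mx_form_sumr (I : finType) (l : I -> C) u A (v : I -> 'cV_m) :
  mx_form u A (\sum_i l i *: v i) = \sum_i l i * mx_form u A (v i).
Proof.
rewrite /mx_form mulmx_sumr summxE; apply: eq_bigr => i _.
by rewrite -scalemxAr mxE.
Qed.

Lemma mx_form_combination a b c (A B E : 'M_m) u v :
  mx_form u (a *: A + b *: B - c *: E) v =
  a * mx_form u A v + b * mx_form u B v - c * mx_form u E v.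
Proof.
by rewrite /mx_form mulmxBr mulmxDr mulmxBl mulmxDl -!scalemxAr -!scalemxAl !mxE.
Qed.

Lemma mx_form_pencil u x v :
  mx_form u (pencil D x) v = \sum_(k < 3) x k * mx_form u (D k) v.
Proof.
rewrite /mx_form mulmx_sumr mulmx_suml summxE; apply: eq_bigr => k _.
by rewrite -scalemxAr -scalemxAl mxE.
Qed.

Definition bezout_form (phi w : blown C m n) : C := \sum_j \sum_j'
  mx_form (phi j') (b12 j j' *: D 0 + b20 j j' *: D 1 - b10 j j' *: D 2) (w j).

Hypotheses (hp : p \is n.-homog) (hq : q \is n.-homog).
Hypothesis hb : bezout_coeffs p q b10 b20 b12.
Variable z : 'I_3 -> C.
Hypothesis z2 : z 2 = 1.

(* With * the cross product, b = (b12, b20, - b10) and U the pencil,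
   (z.(x * y)) (b.D) - (b.(x * y)) (z.D) = (z * b).(y U(x) - x U(y)), whose right-hand
   side is killed by phi (in y) and w (in x); and z.(x * y) is
   lambda(x) mu(y) - mu(x) lambda(y). *)
Lemma bezout_form_identity (phi w : blown C m n.+1) :
  phi \in principal n.+1 (fun k => (D k)^T) -> w \in principal n.+1 D ->
  bezout_form (contract (form z 0 1) phi) (contract (form z 1 0) w)
  - bezout_form (contract (form z 1 0) phi) (contract (form z 0 1) w) =
  mx_form (applyf q phi) (pencil D z) (applyf p w)
  - mx_form (applyf p phi) (pencil D z) (applyf q w).
Proof.
move=> /principalP Vphi /principalP Vw.
pose T k i i' := mx_form (phi i') (D k) (w i).
pose Tz i i' := \sum_(k < 3) z k * T k i i'.
have Rw j i' : \sum_(k < 3) T k (s j k) i' = 0.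
  transitivity (((phi i')^T *m \sum_(k < 3) D k *m w (s j k)) 0 0).
    by rewrite mulmx_sumr summxE; apply: eq_bigr => k _; rewrite mulmxA.
  by rewrite (Vw j) mulmx0 mxE.
have Rphi i j' : \sum_(k < 3) T k i (s j' k) = 0.
  transitivity (((\sum_(k < 3) (D k)^T *m phi (s j' k))^T *m w i) 0 0).
    rewrite raddf_sum mulmx_suml summxE; apply: eq_bigr => k _.
    by rewrite /= trmx_mul trmxK.
  by rewrite (Vphi j') trmx0 mul0mx mxE.
(* The right-hand side is the Bezout identity evaluated on [Tz]; the rest compares the summands for
   each j, j'. *)
transitivity (bezout_pairing b10 b20 b12 Tz); last first.
  rewrite -(bezout_bilinear hp hq hb) /applyf !mx_form_suml -sumrB.
  under [RHS]eq_bigr do rewrite !mx_form_sumr !mulr_sumr -sumrB.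
  rewrite exchange_big; apply: eq_bigr => i _; apply: eq_bigr => i' _ /=.
  by rewrite mx_form_pencil /Tz -/(T _ _ _); ring.
rewrite /bezout_form /bezout_pairing -sumrB; apply: eq_bigr => j _.
rewrite -sumrB; apply: eq_bigr => j' _.
have contractE l l' A : mx_form (contract l phi j') A (contract l' w j) =
    \sum_(k < 3) \sum_(k' < 3) l k * (l' k' * mx_form (phi (s j' k)) A (w (s j k'))).
  rewrite !ffunE mx_form_suml; apply: eq_bigr => k _.
  by rewrite mx_form_sumr mulr_sumr.
rewrite !mx_form_combination !contractE !sum_ord3 /form /= /Tz !sum_ord3 z2.
rewrite -![mx_form _ _ _]/(T _ _ _).
have := (Rw j (s j' 0), Rw j (s j' 1), Rw j (s j' 2)); rewrite !sum_ord3.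
move=> [[/addr0_eq e0 /addr0_eq e1] /addr0_eq e2].
have := (Rphi (s j 0) j', Rphi (s j 1) j', Rphi (s j 2) j'); rewrite !sum_ord3.
move=> [[/addr0_eq f0 /addr0_eq f1] /addr0_eq f2].
(* [e2] and [f2] express the same value of [T 2]; comparing them gives this relation. *)
have g : T 1 (s j 1) (s j' 2) =
    T 0 (s j 2) (s j' 0) + T 1 (s j 2) (s j' 1) - T 0 (s j 0) (s j' 2).
  apply/eqP; rewrite eq_sym subr_eq [eqbRHS]addrC -eqr_opp; apply/eqP.
  by rewrite f2 e2.
by rewrite -e0 -e1 -e2 -f0 -f1 g; ring.
Qed.
End BilinearIdentity.

(** * The kernel of the Bezout form and the common zeros *)

Lemma det0_kernel (K : fieldType) m (A : 'M[K]_m) :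
  \det A = 0 <-> exists2 v : 'cV_m, v != 0 & A *m v = 0.
Proof.
rewrite -det_tr; split=> [/eqP/det0P[v v0 E] | [v v0 E]].
  by exists v^T; [rewrite trmx_eq0 | apply: trmx_inj; rewrite trmx_mul trmxK trmx0].
apply/eqP/det0P; exists v^T; first by rewrite trmx_eq0.
by rewrite -trmx_mul E trmx0.
Qed.

Lemma exists_notin (K : numDomainType) (s : seq K) : exists c, c \notin s.
Proof.
pose t : seq K := [seq i%:R | i <- iota 0 (size s).+1].
have ut : uniq t.
  by rewrite map_inj_uniq ?iota_uniq // => i j /eqP; rewrite eqr_nat => /eqP.
have [/hasP[c _ cs]|/hasPn h] := boolP (has (fun c => c \notin s) t).
  by exists c.
have := uniq_leq_size ut (fun c ct => negbNE (h c ct)).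
by rewrite size_map size_iota ltnn.
Qed.

Section BezoutKernel.
Variables (C : numClosedFieldType) (m n : nat) (D : 'I_3 -> 'M[C]_m).
Variables (p q : {mpoly C[3]}) (b10 b20 b12 : mindex n -> mindex n -> C).
Variable z : 'I_3 -> C.

Local Notation Dt := (fun k => (D k)^T).
Local Notation beta := (@bezout_form C m n D b10 b20 b12).

Lemma bezout_form_linearl a phi1 phi2 w :
  beta (a *: phi1 + phi2) w = a * beta phi1 w + beta phi2 w.
Proof.
rewrite /bezout_form mulr_sumr -big_split; apply: eq_bigr => j _ /=.
rewrite mulr_sumr -big_split; apply: eq_bigr => j' _ /=.
by rewrite !ffunE /mx_form linearP /= !mulmxDl -!scalemxAl !mxE.
Qed.

Lemma bezout_form_linearr a phi w1 w2 :
  beta phi (a *: w1 + w2) = a * beta phi w1 + beta phi w2.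
Proof.
rewrite /bezout_form mulr_sumr -big_split; apply: eq_bigr => j _ /=.
rewrite mulr_sumr -big_split; apply: eq_bigr => j' _ /=.
by rewrite !ffunE /mx_form mulmxDr -!scalemxAr !mxE.
Qed.

Lemma bezout_form0l w : beta 0 w = 0.
Proof.
by have := bezout_form_linearl (-1) 0 0 w; rewrite scaler0 addr0 mulN1r addNr.
Qed.

Lemma bezout_form_suml (I : finType) (c : I -> C) phi w :
  beta (\sum_i c i *: phi i) w = \sum_i c i * beta (phi i) w.
Proof.
elim/big_rec2: _ => [|i y x _ <-]; first exact: bezout_form0l.
exact: bezout_form_linearl.
Qed.

(** Pairing with a basis presents the kernel of [beta] as the kernel of a linear map. *)
Definition bezout_row (w : blown C m n) : 'rV[C]_(\dim (principal n Dt)) :=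
  \row_i beta (vbasis (principal n Dt))`_i w.

Lemma bezout_row_linear : linear bezout_row.
Proof. by move=> a w1 w2; apply/rowP => i; rewrite !mxE bezout_form_linearr. Qed.

HB.instance Definition _ :=
  GRing.isSemilinear.Build C (blown C m n) 'rV[C]_(\dim (principal n Dt)) _
    bezout_row (GRing.semilinear_linear bezout_row_linear).

Definition bezout_kernel : {vspace blown C m n} :=
  (principal n D :&: lker (linfun bezout_row))%VS.

Lemma bezout_kernelP w : reflect
  (w \in principal n D /\ forall phi, phi \in principal n Dt -> beta phi w = 0)
  (w \in bezout_kernel).
Proof.
rewrite memv_cap [X in _ && X]memv_ker lfunE /=.
apply: (iffP andP) => -[wV h]; split=> //.
  move=> phi phiV; rewrite (coord_vbasis phiV) bezout_form_suml big1 // => i _.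
  by have /eqP/rowP/(_ i) := h; rewrite !mxE => ->; rewrite mulr0.
by apply/eqP/rowP => i; rewrite !mxE h // vbasis_mem // mem_nth // size_tuple.
Qed.

Hypotheses (hp : p \is n.-homog) (hq : q \is n.-homog).
Hypothesis hb : bezout_coeffs p q b10 b20 b12.
Hypotheses (z2 : z 2 = 1) (Uz : pencil D z \in unitmx).

Lemma pencil_tr x : pencil Dt x = (pencil D x)^T.
Proof. by rewrite /pencil raddf_sum; apply: eq_bigr => k _; rewrite /= linearZ. Qed.

Lemma Uzt : pencil Dt z \in unitmx.
Proof. by rewrite pencil_tr unitmx_tr. Qed.

Lemma form_combination s1 s2 n' (w : blown C m n'.+1) :
  contract (form z s1 s2) w =
  s1 *: contract (form z 1 0) w + s2 *: contract (form z 0 1) w.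
Proof.
rewrite -contractD; apply/ffunP => j; rewrite !ffunE; apply: eq_bigr => k _.
by congr (_ *: _); elim/ord3_ind: k; rewrite /form /=; ring.
Qed.

(** Contraction by lambda or mu scales the evaluation at x by the value there, and p, q kill it. By
    the identity, [beta] vanishes between it and every contraction by [- mx] lambda + [lx] mu; these
    contractions fill the transposed principal space. *)
Lemma common_zero_kernel x (v : 'cV[C]_m) : (0 < n)%N -> (exists k, x k != 0) ->
  v != 0 -> pencil D x *m v = 0 -> p.@[x] = 0 -> q.@[x] = 0 ->
  bezout_kernel != 0%VS.
Proof.
move=> n0 [k xk] v0 xv px qx.
have w0 : point_functional n x v != 0.
  have d0 : (mdeg (U_(k) *+ n.-1)%MM).+1 == n by rewrite mdegMn mdeg1 mul1n prednK.
  apply: contra_neq v0 => /ffunP/(_ (mk_mindex d0)); rewrite !ffunE => /eqP.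
  rewrite scaler_eq0 => /orP[|/eqP//]; rewrite /monomial (bigD1 k) //= big1.
    by rewrite mulr1 expf_eq0 (negPf xk) andbF.
  by move=> l lk; rewrite mulmnE mnm1E eq_sym (negPf lk) mul0n expr0.
apply: contraNneq w0 => N0; rewrite -memv0 -N0; apply/bezout_kernelP.
split=> [|phi phiV]; first exact: point_functional_principal.
pose lx := \sum_(i < 3) form z 1 0 i * x i; pose mx := \sum_(i < 3) form z 0 1 i * x i.
(* If both values were 0, x would be a multiple of z, where the pencil is invertible. *)
have lm0 : (- mx != 0) || (lx != 0).
  rewrite oppr_eq0 -negb_and; apply: contra v0 => /andP[/eqP mx0 /eqP lx0].
  have xE i : x i = x 2 * z i.
    move: mx0 lx0; rewrite /mx /lx !sum_ord3 /form /= => mx0 lx0.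
    elim/ord3_ind: i; rewrite ?z2 ?mulr1 //; apply/eqP; rewrite -subr_eq0; apply/eqP.
      by rewrite -[RHS]lx0; ring.
    by rewrite -[RHS]mx0; ring.
  have x2 : x 2 != 0 by apply: contraNneq xk => x20; rewrite xE x20 mul0r.
  have := xv; rewrite /pencil (eq_bigr (fun i => x 2 *: (z i *: D i))).
    rewrite -scaler_sumr -scalemxAl => /eqP; rewrite scaler_eq0 (negPf x2) /= => /eqP E.
    by rewrite -[v](mulKmx Uz) E mulmx0.
  by move=> i _; rewrite xE scalerA.
have [u uV <-] := contract_surj z2 Uzt lm0 phiV.
rewrite form_combination bezout_form_linearl.
rewrite -[_ *: contract _ u]addr0 bezout_form_linearl bezout_form0l addr0.
have := bezout_form_identity hp hq hb z2 uV (point_functional_principal n.+1 xv).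
rewrite !applyf_point // px qx !scale0r !contract_point -/lx -/mx.
rewrite /mx_form !mulmx0 mxE subrr -[lx *: _]addr0 -[mx *: _]addr0 !bezout_form_linearr.
have z0 phi' : beta phi' 0 = 0.
  by have := bezout_form_linearr (-1) phi' 0 0; rewrite scaler0 addr0 mulN1r addNr.
by rewrite !z0 !addr0 => E; rewrite addrC mulNr.
Qed.

(** U(a + e z) is singular exactly when -e is an eigenvalue of U(z)^-1 U(a). *)
Lemma singular_points_finite s1 s2 : exists es : seq C, forall e (v : 'cV[C]_m),
  v != 0 -> pencil D (line_point z s1 s2 e) *m v = 0 -> e \in es.
Proof.
pose a := line_point z s1 s2 0; pose M := invmx (pencil D z) *m pencil D a.
have [r rE] := closed_field_poly_normal (char_poly M).
exists (map -%R r) => e v v0; rewrite pencil_line_point => xv.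
rewrite -[e]opprK map_f //.
suff : root (char_poly M) (- e).
  by rewrite rE rootZ ?root_prod_XsubC // lead_coef_eq0 -size_poly_gt0 size_char_poly.
(* Eigenvalues are defined by row vectors, so the kernel column is exchanged for a kernel row
   [u]. *)
have /det0_kernel/eqP/det0P[u u0] : exists2 v : 'cV_m, v != 0 &
    (pencil D a + e *: pencil D z) *m v = 0 by exists v.
rewrite mulmxDr -scalemxAr => /eqP; rewrite addr_eq0 -scaleNr => /eqP uE.
rewrite -eigenvalue_root_char; apply/eigenvalueP; exists (u *m pencil D z).
  by rewrite mulmxA mulmxK.
by apply: contra_neq u0 => E; rewrite -(mulmxK Uz u) E mul0mx.
Qed.

Lemma kernel_common_zero : nonvanishing_on_line z D 1 0 p ->
  bezout_kernel != 0%VS -> exists x (v : 'cV[C]_m),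
  [/\ exists k, x k != 0, v != 0, pencil D x *m v = 0, p.@[x] = 0 & q.@[x] = 0].
Proof.
move=> pn N0.
have s10 : ((1 : C) != 0) || ((0 : C) != 0) by rewrite oner_neq0.
(* U(x) and its transpose are singular at the same points. *)
have pnt : nonvanishing_on_line z Dt 1 0 p.
  move=> e v v0; rewrite pencil_tr => xv.
  have /det0_kernel : exists2 v : 'cV_m, v != 0 &
    (pencil D (line_point z 1 0 e))^T *m v = 0 by exists v.
  by rewrite det_tr => /det0_kernel[u u0 /(pn e u u0)].
pose lam := linfun (@contract C m n (form z 1 0)).
pose mu := linfun (@contract C m n (form z 0 1)).
(* Lifts of kernel vectors through lambda, among the functionals that kill p. *)
pose Nhat := (principal n.+1 D :&: (lker (linfun (@applyf C m n.+1 p)) :&: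
  lam @^-1: bezout_kernel))%VS.
have NhatP u : reflect [/\ u \in principal n.+1 D, applyf p u = 0 &
    contract (form z 1 0) u \in bezout_kernel] (u \in Nhat).
  apply: (iffP memv_capP) => [[uV /memv_capP[]] | [uV up uN]].
    by rewrite memv_ker -memv_preim !lfunE => /eqP up uN.
  by split=> //; apply/memv_capP; rewrite memv_ker -memv_preim !lfunE /= up.
have lamN : (lam @: Nhat)%VS = bezout_kernel.
  apply/eqP; rewrite eqEsubv; apply/andP; split; apply/subvP => w.
    by case/memv_imgP => u /NhatP[_ _ uN] ->; rewrite lfunE.
  move=> /[dup] wN /bezout_kernelP[wV _].
  have [u [uV uw up]] := contract_applyf_surj z2 Uz 0 s10 hp pn wV.
  apply/memv_imgP; exists u; last by rewrite lfunE /= uw.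
  by apply/NhatP; split; rewrite ?uw.
have dimN : (\dim bezout_kernel <= \dim Nhat)%N.
  by rewrite -lamN -(limg_ker_dim lam Nhat) leq_addl.
have Nhat0 : Nhat != 0%VS.
  by apply: contraNneq N0 => E; rewrite -lamN E limg0.
(* Two terms of the identity drop out: lambda sends [u] to a kernel vector, and [u] kills p. *)
have Nhat_identity u phi : u \in Nhat -> phi \in principal n.+1 Dt ->
    beta (contract (form z 1 0) phi) (contract (form z 0 1) u) =
    mx_form (applyf p phi) (pencil D z) (applyf q u).
  move=> /NhatP[uV up /bezout_kernelP[_ uN]] phiV.
  have := bezout_form_identity hp hq hb z2 phiV uV.
  rewrite up uN ?contract_principal // /mx_form mulmx0 mxE !sub0r.
  exact: oppr_inj.
have Nhat_q u : u \in Nhat -> applyf q u = 0.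
  move=> uN; suff E : pencil D z *m applyf q u = 0.
    by rewrite -[applyf q u](mulKmx Uz) E mulmx0.
  apply/colP => i; rewrite [RHS]mxE.
  (* A [phi] killed by lambda and with the i-th basis vector as value at p isolates the i-th entry
     of U(z) u(q). *)
  have [phi [phiV phi0 phip]] :=
    contract_applyf_surj z2 Uzt (delta_mx i 0) s10 hp pnt (mem0v _).
  have := Nhat_identity u phi uN phiV; rewrite phi0 bezout_form0l phip /mx_form.
  by rewrite trmx_delta -mulmxA -rowE mxE.
have muN : (mu @: Nhat <= bezout_kernel)%VS.
  apply/subvP => _ /memv_imgP[u uN ->]; rewrite lfunE /=; apply/bezout_kernelP.
  split=> [|phi phiV]; first by have /NhatP[uV _ _] := uN; apply: contract_principal.
  have [psi psiV <-] := contract_surj z2 Uzt s10 phiV.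
  by rewrite Nhat_identity // Nhat_q // /mx_form mulmx0 mxE.
have lamN' : (lam @: Nhat <= bezout_kernel)%VS by rewrite lamN.
(* Both contractions map [Nhat] into a space of no larger dimension. *)
have [s1 [s2 [u [s0 uN u0 E]]]] := singular_pencil Nhat0 dimN lamN' muN.
rewrite !lfunE /= -form_combination in E.
pose Y := (principal n.+1 D :&: (lker (linfun (@contract C m n (form z s1 s2))) :&:
  (lker (linfun (@applyf C m n.+1 p)) :&: lker (linfun (@applyf C m n.+1 q)))))%VS.
have YP w : reflect [/\ w \in principal n.+1 D, contract (form z s1 s2) w = 0,
    applyf p w = 0 & applyf q w = 0] (w \in Y).
  apply: (iffP memv_capP) => [[wV /memv_capP[wt /memv_capP[wp wq]]] | [wV wt wp wq]].
    by rewrite !memv_ker !lfunE in wt wp wq; split=> //; apply/eqP.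
  by split=> //; apply/memv_capP; rewrite memv_ker lfunE /= wt; split=> //;
    apply/memv_capP; rewrite !memv_ker !lfunE /= wp wq.
have Y0 : Y != 0%VS.
  apply: contraNneq u0 => Y0; rewrite -memv0 -Y0; apply/YP.
  by have /NhatP[? ? _] := uN; split=> //; exact: Nhat_q.
have [|||e [v [v0 xv /YP[_ _]]]] := point_functional_exists z2 Uz s0 Y0.
- by move=> w /YP[].
- by move=> w /YP[].
- move=> A w /YP[wV wt wp wq] AV At; apply/YP.
  by split; rewrite // applyf_lmul ?wp ?wq mulmx0.
rewrite !applyf_point // => /eqP px /eqP qx.
move: px qx; rewrite !scaler_eq0 (negPf v0) !orbF => /eqP px /eqP qx.
by exists (line_point z s1 s2 e), v; split=> //; exact: line_point_neq0.
Qed.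
End BezoutKernel.

(** * From the determinant of the compressed matrix to common zeros *)

Section Criterion.
Variables (C : numClosedFieldType) (m n : nat) (D : 'I_3 -> 'M[C]_m).
Variables (p q : {mpoly C[3]}) (b10 b20 b12 : mindex n -> mindex n -> C).

Lemma Delta_eval x : (Delta D).@[x] = \det (pencil D x).
Proof.
rewrite /Delta -det_map_mx; congr (\det _); apply/matrixP => i j.
rewrite mxE !summxE raddf_sum; apply: eq_bigr => k _ /=.
by rewrite !mxE mevalM mevalXU mevalC.
Qed.

Lemma pencil_unit_exists : Delta D != 0 ->
  exists2 z : 'I_3 -> C, z 2 = 1 & pencil D z \in unitmx.
Proof.
move=> D0.
(* The factor ['X_2] allows the point to be scaled to third coordinate 1. *)
have [x] : exists x : 'I_3 -> C, (Delta D * 'X_2).@[x] != 0.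
  apply: boolp.contrapT => h.
  have : Delta D * 'X_2 = 0.
    apply: mpoly_eval0 => x; apply/eqP/negPn/negP => hx; apply: h.
    by exists x.
  move/eqP; rewrite mulf_eq0 (negPf D0) => /eqP/(congr1 (meval (fun=> 1))).
  by rewrite mevalXU meval0 => /eqP; rewrite oner_eq0.
rewrite mevalM mevalXU mulf_eq0 negb_or Delta_eval => /andP[Dx x2].
exists (fun k => (x 2)^-1 * x k); first by rewrite mulVf.
have -> : pencil D (fun k => (x 2)^-1 * x k) = (x 2)^-1 *: pencil D x.
  by rewrite /pencil scaler_sumr; apply: eq_bigr => k _; rewrite scalerA.
by rewrite unitmxZ ?unitfE ?invr_eq0 // unitmxE unitfE.
Qed.

(** The expression p(x) q(y) - q(x) p(y) is alternating in p and q, so the same matrices, and the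
    same kernel, serve for p + c q. *)
Lemma bezout_coeffs_shift c : bezout_coeffs p q b10 b20 b12 ->
  bezout_coeffs (p + c *: q) q b10 b20 b12.
Proof.
case=> s10 s20 s12 h; split=> // x y /=; rewrite -[RHS]h.
by rewrite !mevalD !mevalZ; ring.
Qed.

Lemma common_zero_iff_kernel : Delta D != 0 -> (0 < n)%N ->
  p \is n.-homog -> q \is n.-homog -> bezout_coeffs p q b10 b20 b12 ->
  common_zero_on D p q <-> bezout_kernel D b10 b20 b12 != 0%VS.
Proof.
move=> D0 n0 hp hq hb; have [z z2 Uz] := pencil_unit_exists D0.
split=> [[x [x0 Dx px qx]] | N0].
  move: Dx; rewrite Delta_eval => /det0_kernel[v v0 xv].
  exact: (common_zero_kernel hp hq hb z2 Uz n0 x0 v0 xv px qx).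
have [es esP] := singular_points_finite Uz 1 0.
pose pt e := line_point z 1 0 e.
(* [c] avoids the ratios -p/q at the singular points of the line; where q vanishes the quotient is 0
   by convention, which only excludes c = 0. *)
have [c hc] := exists_notin [seq - (p.@[pt e] / q.@[pt e]) | e <- es].
have [/hasP[e _ /and3P[/eqP De /eqP pe /eqP qe]] | nz] := boolP (has (fun e =>
    [&& \det (pencil D (pt e)) == 0, p.@[pt e] == 0 & q.@[pt e] == 0]) es).
  exists (pt e); split=> //; last by rewrite Delta_eval.
  by apply: line_point_neq0 => //; rewrite oner_neq0.
have pn : nonvanishing_on_line z D 1 0 (p + c *: q).
  move=> e v v0 xv; have ees := esP e v v0 xv.
  have De : \det (pencil D (pt e)) = 0 by apply/det0_kernel; exists v.
  move/hasPn/(_ e ees): nz; rewrite De eqxx /= negb_and => nz.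
  rewrite mevalD mevalZ -/(pt e); have [qe|qe] := eqVneq q.@[pt e] 0.
    by move: nz; rewrite qe eqxx orbF mulr0 addr0.
  apply: contra hc; rewrite addrC addr_eq0 => /eqP E; apply/mapP; exists e => //.
  by rewrite -mulNr -E mulfK.
have hpc : p + c *: q \is n.-homog by rewrite rpredD // rpredZ.
have [x [v [x0 v0 xv px qx]]] := kernel_common_zero hpc hq
  (bezout_coeffs_shift c hb) z2 Uz pn N0.
exists x; split=> //; first by rewrite Delta_eval; apply/det0_kernel; exists v.
by rewrite -px mevalD mevalZ qx mulr0 addr0.
Qed.

Lemma orthoproj_eq0 (V : {vspace blown C m n}) w :
  orthoproj V w = 0 <-> forall phi, phi \in V -> blown_dot w phi = 0.
Proof.
split=> [w0 phi phiV | h].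
  by rewrite -(orthoproj_ortho w phiV) w0 subr0.
apply/eqP/negPn/negP => /blown_dot_gt0; rewrite lt0r => /andP[/eqP ne _]; apply: ne.
have PV := orthoproj_mem V w.
have := orthoproj_ortho w PV; rewrite linearBl /= h // sub0r => /eqP.
by rewrite oppr_eq0 => /eqP.
Qed.

Lemma orthoproj_id (V : {vspace blown C m n}) w : w \in V -> orthoproj V w = w.
Proof. by apply: daddv_pi_id; exact: orthov_disjoint. Qed.

(** On V_n the right-hand projection is the identity, and the left-hand one kills exactly the
    vectors orthogonal to V_n. *)
Lemma bezout_along_det0 :
  lfun_det (bezout_along D b10 b20 b12) = 0 <-> exists w, [/\ w \in principal n D,
    w != 0 & forall phi, phi \in principal n D ->
      blown_dot (bezout D b10 b20 b12 w) phi = 0].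
Proof.
pose V := principal n D.
have alongE u : bezout_along D b10 b20 b12 u =
    vsproj V (orthoproj V (bezout D b10 b20 b12 (vsval u))).
  by rewrite /bezout_along !comp_lfunE !lfunE /= (orthoproj_id (subvsP u)).
rewrite lfun_det_eq0; split=> [[u u0] | [w [wV w0 h]]].
  rewrite alongE => /(congr1 vsval); rewrite vsprojK ?orthoproj_mem //.
  rewrite [RHS]linear0 => /orthoproj_eq0 h; exists (vsval u); split=> //.
  exact: subvsP.
exists (vsproj V w); first by apply: contra_neq w0 => E; rewrite -(vsprojK wV) E.
by rewrite alongE vsprojK // (iffRL (orthoproj_eq0 V _) h) linear0.
Qed.

(** Conjugation turns the Hermitian product into the bilinear [bezout_form]. *)
Definition conj_functional (phi : blown C m n) : blown C m n :=
  [ffun i => map_mx Num.conj (phi i)].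

Lemma blown_dot_bezout phi w : bezout_coeffs p q b10 b20 b12 ->
  blown_dot (bezout D b10 b20 b12 w) phi =
  bezout_form D b10 b20 b12 (conj_functional phi) w.
Proof.
case=> s10 s20 s12 _; rewrite /blown_dot /bezout_form [RHS]exchange_big /=.
apply: eq_bigr => i _.
pose A j := b12 j i *: D 0 + b20 j i *: D 1 - b10 j i *: D 2.
have -> : bezout D b10 b20 b12 w i = \sum_j A j *m w j.
  rewrite /bezout !(add_lfunE, opp_lfunE, lfunE) /= !ffunE -big_split /= -sumrB.
  apply: eq_bigr => j _; rewrite /A mulmxBl mulmxDl -!scalemxAl.
  (* Symmetry of the Bezout matrices interchanges row and column index. *)
  by rewrite s12 s20 s10.
under [RHS]eq_bigr do rewrite /mx_form -mulmxA -/(A _).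
rewrite -summxE -mulmx_sumr mxE; apply: eq_bigr => k _.
by rewrite !mxE ffunE mxE mulrC.
Qed.

Lemma conj_functionalK : involutive conj_functional.
Proof.
move=> phi; apply/ffunP => i; rewrite !ffunE.
by apply/matrixP => k l; rewrite !mxE conjCK.
Qed.

Lemma conj_functional_principal (E : 'I_3 -> 'M[C]_m) phi :
  phi \in principal n E ->
  conj_functional phi \in principal n (fun k => map_mx Num.conj (E k)).
Proof.
move=> /principalP h; apply/principalP => j.
transitivity (map_mx Num.conj (\sum_(k < 3) E k *m phi (mindex_succ j k))).
  rewrite raddf_sum; apply: eq_bigr => k _.
  by rewrite ffunE /= map_mxM.
by rewrite h map_mx0.
Qed.

(** For Hermitian D_k the conjugate is the transpose, so conjugation exchanges the principal
    subspaces of the D_k and of their transposes and matches the two kinds of test vectors. *)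
Lemma bezout_along_kernel : (forall k, D k \is hermsymmx) ->
  bezout_coeffs p q b10 b20 b12 ->
  lfun_det (bezout_along D b10 b20 b12) = 0 <->
  bezout_kernel D b10 b20 b12 != 0%VS.
Proof.
move=> hD hb.
have hDt k : map_mx Num.conj (D k) = (D k)^T.
  have /is_hermitianmxP := hD k; rewrite expr0 scale1r => {2}->.
  by rewrite map_trmx trmxK.
have conjV phi : phi \in principal n D ->
    conj_functional phi \in principal n (fun k => (D k)^T).
  move=> /conj_functional_principal /principalP h; apply/principalP => j.
  by apply: etrans (h j); apply: eq_bigr => k _; rewrite hDt.
have conjVt phi : phi \in principal n (fun k => (D k)^T) ->
    conj_functional phi \in principal n D.
  move=> /conj_functional_principal /principalP h; apply/principalP => j.
  apply: etrans (h j); apply: eq_bigr => k _.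
  by rewrite -hDt -map_mx_comp map_mx_id //; exact: conjCK.
rewrite bezout_along_det0; split=> [[w [wV w0 h]] | N0].
  apply: contraNneq w0 => N0; rewrite -memv0 -N0; apply/bezout_kernelP.
  split=> // phi /conjVt phiV.
  by have := h _ phiV; rewrite blown_dot_bezout // conj_functionalK.
have /bezout_kernelP[wV h] := memv_pick (bezout_kernel D b10 b20 b12).
exists (vpick (bezout_kernel D b10 b20 b12)); rewrite vpick0; split=> // phi phiV.
by rewrite blown_dot_bezout // h // conjV.
Qed.
End Criterion.

Theorem corollary2p3 (R : realType) (m n : nat) (D : 'I_3 -> 'M[R[i]]_m)
    (hD : forall k, D k \is hermsymmx)
    (hDelta : irreducible_elt (Delta D))
    (hn : (0 < n)%N)
    (p q : {mpoly R[i][3]})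
    (hp : p \is n.-homog) (hq : q \is n.-homog)
    (b10 b20 b12 : mindex n -> mindex n -> R[i])
    (hb : bezout_coeffs p q b10 b20 b12) :
  common_zero_on D p q <-> lfun_det (bezout_along D b10 b20 b12) = 0.
Proof.
have D0 : Delta D != 0 by case: hDelta.
by rewrite (common_zero_iff_kernel D0 hn hp hq hb) (bezout_along_kernel hD hb).
Qed.
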